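(* Let $R$ be an integral domain with quotient field $K$. The following are equivalent: (1) $R$ is a P$v$MD. (2) For every overring $T$ with $R\subseteq T\subseteq K$ and every $\mathfrak m\in w\text{-}\mathrm{Max}(R)$, the localized inclusion $\iota_{\mathfrak m}\colon R_{\mathfrak m}\to T_{\mathfrak m}$ is a flat ring epimorphism; equivalently, the multiplication map $\mu_{\mathfrak m}\colon T_{\mathfrak m}\otimes_{R_{\mathfrak m}}T_{\mathfrak m}\to T_{\mathfrak m}$ is an isomorphism and $T_{\mathfrak m}$ is flat over $R_{\mathfrak m}$. In particular, under (2), each overring $T$ with $R\subseteq T\subseteq K$ is $w$-flat as an $R$-module, and the multiplication map $\mu\colon T\otimes_R T\to T$ has GV-torsion kernel and cokernel, i.e. the inclusion $\iota\colon R\hookrightarrow T$ is a $w$-epimorphism of rings.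
   Context: $R$ is an integral domain with $1\ne 0$; modules are unitary. An overring of $R$ is a ring $T$ with $R\subseteq T\subseteq K$, and $T_{\mathfrak m}=T\otimes_R R_{\mathfrak m}$ is the localization at $R\setminus\mathfrak m$. A finitely generated ideal $J$ of $R$ is a GV-ideal, $J\in \mathrm{GV}(R)$, if the natural map $R\to\operatorname{Hom}_R(J,R)$, $r\mapsto (x\mapsto rx)$, is an isomorphism. An $R$-module $M$ is GV-torsion if for every $x\in M$ there is $J\in\mathrm{GV}(R)$ with $Jx=0$, and GV-torsion-free if $Jx=0$ with $J\in\mathrm{GV}(R)$, $x\in M$ forces $x=0$. For $M$ GV-torsion-free with injective envelope $E(M)$, $M_w=\{x\in E(M): Jx\subseteq M\text{ for some }J\in \mathrm{GV}(R)\}$, and $M$ is a $w$-module if $M_w=M$. A $w$-ideal is an ideal of $R$ that is a $w$-module; $w\text{-}\mathrm{Max}(R)$ is the set of ideals maximal among proper $w$-ideals (these are prime). $R$ is a P$v$MD (Prüfer $v$-multiplication domain) if every nonzero finitely generated ideal $I$ of $R$ is $w$-invertible, i.e. $(II^{-1})_w=R$, where $I^{-1}=\{x\in K: Ix\subseteq R\}$. An $R$-module $F$ is $w$-flat if $\operatorname{Tor}^R_1(N,F)$ is GV-torsion for all $R$-modules $N$. A ring homomorphism $\varphi\colon A\to S$ (of commutative rings) is a ring epimorphism if $\alpha\varphi=\beta\varphi$ implies $\alpha=\beta$ for all ring maps $\alpha,\beta$ out of $S$; it is a flat epimorphism if moreover $S$ is a flat $A$-module. A ring homomorphism $R\to T$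 is a $w$-epimorphism of rings if the multiplication map $T\otimes_R T\to T$ has GV-torsion kernel and cokernel. *)

(* Defs.v *)
From HB Require Import structures.
From mathcomp Require Import all_boot all_algebra.
From mathcomp Require Import boolp.
From mathcomp Require Import freeg.

Set Implicit Arguments.
Unset Strict Implicit.
Unset Printing Implicit Defensive.

Import GRing.Theory.
Local Open Scope ring_scope.
Local Open Scope quotient_scope.

(* Submodules are the closed boolean predicates [submodClosed M]. Classically
   every subset is of this form, so quantifying over them loses nothing. *)

Section Submodules.
Variables (A : nzRingType) (M : lmodType A).

Record submod (S : submodClosed M) : Type :=
  Submod { submod_val : M; submodP : submod_val \in S }.

HB.instance Definition _ (S : submodClosed M) :=
  [isSub for @submod_val S].
HB.instance Definition _ (S : submodClosed M) := [Choice of submod S by <:].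
HB.instance Definition _ (S : submodClosed M) :=
  [SubChoice_isSubLmodule of submod S by <:].

Definition span (G : M -> Prop) : {pred M} :=
  fun x => `[< forall S : submodClosed M, (forall g, G g -> g \in S) -> x \in S >].

Fact span_submod_closed (G : M -> Prop) : submod_closed (span G).
Proof.
split=> [|a x y /asboolP xG /asboolP yG]; apply/asboolP=> S GS.
  exact: rpred0.
by rewrite rpredD ?rpredZ ?xG ?yG.
Qed.
HB.instance Definition _ (G : M -> Prop) :=
  GRing.isSubmodClosed.Build A M (span G) (span_submod_closed G).

Definition finitely_generated (S : submodClosed M) : Prop :=
  exists (n : nat) (g : 'I_n -> M),
    forall x, x \in S <-> exists c : 'I_n -> A, x = \sum_(i < n) c i *: g i.

End Submodules.

Section KernelImage.
Variables (A : nzRingType) (M N : lmodType A).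

Definition ker (f : {linear M -> N}) : {pred M} := fun x => f x == 0.

Fact ker_submod_closed (f : {linear M -> N}) : submod_closed (ker f).
Proof.
split=> [|a x y]; rewrite !unfold_in /ker ?linear0 // => /eqP fx /eqP fy.
by rewrite linearP fx fy scaler0 addr0.
Qed.
HB.instance Definition _ (f : {linear M -> N}) :=
  GRing.isSubmodClosed.Build A M (ker f) (ker_submod_closed f).

Definition im (f : {linear M -> N}) : {pred N} :=
  fun y => `[< exists x, f x = y >].

Fact im_submod_closed (f : {linear M -> N}) : submod_closed (im f).
Proof.
split=> [|a _ _ /asboolP[x <-] /asboolP[y <-]]; apply/asboolP.
  by exists 0; rewrite linear0.
by exists (a *: x + y); rewrite linearP.
Qed.
HB.instance Definition _ (f : {linear M -> N}) :=
  GRing.isSubmodClosed.Build A N (im f) (im_submod_closed f).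

Definition preim (f : {linear M -> N}) (S : submodClosed N) : {pred M} :=
  fun x => f x \in S.

Fact preim_submod_closed (f : {linear M -> N}) (S : submodClosed N) :
  submod_closed (preim f S).
Proof.
split=> [|a x y fx fy].
  by change (f 0 \in S); rewrite linear0 rpred0.
change (f (a *: x + y) \in S); rewrite linearP; apply: rpredD; last exact: fy.
by apply: rpredZ; exact: fx.
Qed.
HB.instance Definition _ (f : {linear M -> N}) (S : submodClosed N) :=
  GRing.isSubmodClosed.Build A M (preim f S) (preim_submod_closed f S).

End KernelImage.

Section QuotientModule.
Variables (A : nzRingType) (M : lmodType A) (S : submodClosed M).

(* [S] as an additive subgroup, the form expected by [Quotient.quot]. *)
Definition submod_zmod : {pred M} := fun x => x \in S.
Fact submod_zmod_closed : zmod_closed submod_zmod.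
Proof. exact: (GRing.submod_closedB (submodClosedP S)). Qed.
HB.instance Definition _ :=
  GRing.isZmodClosed.Build M submod_zmod submod_zmod_closed.

Definition quotmod : Type := Quotient.quot submod_zmod.

HB.instance Definition _ := GRing.Zmodule.on quotmod.
HB.instance Definition _ : EqQuotient M (Quotient.equiv submod_zmod) quotmod :=
  EqQuotient.on quotmod.
HB.instance Definition _ :=
  isZmodQuotient.Build M (Quotient.equiv submod_zmod) 0 -%R +%R quotmod
    (lock _) (@Quotient.pi_opp _ submod_zmod) (@Quotient.pi_add _ submod_zmod).

Definition quotmod_pi : M -> quotmod := \pi_quotmod.

Lemma quotmod_piE x y : (quotmod_pi x == quotmod_pi y) = (x - y \in S).
Proof. by rewrite -Quotient.idealrBE. Qed.

Lemma quotmod_pi_repr q : quotmod_pi (repr q) = q.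
Proof. exact: reprK. Qed.

Fact quotmod_pi_is_zmod_morphism : zmod_morphism quotmod_pi.
Proof. by move=> x y; rewrite /quotmod_pi raddfB. Qed.

Definition quotmod_scale (a : A) (q : quotmod) : quotmod :=
  quotmod_pi (a *: repr q).

Lemma quotmod_piZ a x : quotmod_scale a (quotmod_pi x) = quotmod_pi (a *: x).
Proof.
apply/eqP; rewrite quotmod_piE -scalerBr rpredZ // -quotmod_piE.
by rewrite quotmod_pi_repr.
Qed.

Let piD x y : quotmod_pi (x + y) = quotmod_pi x + quotmod_pi y.
Proof. by rewrite /quotmod_pi raddfD. Qed.

Fact quotmod_scaleA a b q :
  quotmod_scale a (quotmod_scale b q) = quotmod_scale (a * b) q.
Proof. by rewrite -[q]quotmod_pi_repr !quotmod_piZ scalerA. Qed.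
Fact quotmod_scale1 : left_id 1 quotmod_scale.
Proof. by move=> q; rewrite -[q]quotmod_pi_repr quotmod_piZ scale1r. Qed.
Fact quotmod_scaleDr : right_distributive quotmod_scale +%R.
Proof.
move=> a p q; rewrite -[p]quotmod_pi_repr -[q]quotmod_pi_repr.
by rewrite -piD !quotmod_piZ -piD scalerDr.
Qed.
Fact quotmod_scaleDl q : {morph quotmod_scale^~ q : a b / a + b}.
Proof.
by move=> a b; rewrite -[q]quotmod_pi_repr !quotmod_piZ -piD scalerDl.
Qed.
HB.instance Definition _ := GRing.Zmodule_isLmodule.Build A quotmod
  quotmod_scaleA quotmod_scale1 quotmod_scaleDr quotmod_scaleDl.

HB.instance Definition _ := GRing.isZmodMorphism.Build M quotmod quotmod_pi
  quotmod_pi_is_zmod_morphism.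
Fact quotmod_pi_is_scalable : scalable quotmod_pi.
Proof. by move=> a x; rewrite -quotmod_piZ. Qed.
HB.instance Definition _ := GRing.isScalable.Build A M quotmod *:%R quotmod_pi
  quotmod_pi_is_scalable.

End QuotientModule.

(* [{freeg X / A}] is the free A-module on X; [fglift g] extends a map
   [g : X -> M] to it. *)
Section FreeModule.
Variables (A : comNzRingType) (X : choiceType) (M : lmodType A) (g : X -> M).

Definition free_lift : {freeg X / A} -> M := fglift g.

Fact free_lift_is_zmod_morphism : zmod_morphism free_lift.
Proof. exact: lift_is_additive. Qed.
HB.instance Definition _ :=
  GRing.isZmodMorphism.Build {freeg X / A} M free_lift
    free_lift_is_zmod_morphism.

Lemma free_liftU k x : free_lift << k *g x >> = k *: g x.
Proof. exact: liftU. Qed.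

Fact free_lift_is_scalable : scalable free_lift.
Proof.
move=> a D; rewrite -[in RHS](freeg_sumE D).
rewrite [a *: D]/(fgscale a D) /fgscale !raddf_sum /=; apply: eq_bigr => x _.
by rewrite !free_liftU scalerA.
Qed.
HB.instance Definition _ :=
  GRing.isScalable.Build A {freeg X / A} M *:%R free_lift
    free_lift_is_scalable.

End FreeModule.

Section TensorProduct.
Variable A : comNzRingType.
Implicit Types M N P : lmodType A.

Definition tensor_relator M N (z : {freeg (M * N) / A}) : Prop :=
  [\/ exists a x x' y,
        z = << (a *: x + x', y) >> - a *: << (x, y) >> - << (x', y) >>
    | exists a x y y',
        z = << (x, a *: y + y') >> - a *: << (x, y) >> - << (x, y') >> ].

Definition tensor M N : Type := quotmod (span (@tensor_relator M N)).
HB.instance Definition _ M N := GRing.Lmodule.on (tensor M N).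

Definition tens M N (x : M) (y : N) : tensor M N :=
  quotmod_pi (span (@tensor_relator M N)) << (x, y) >>.

Fact tens_bilinear M N : bilinear_for *:%R *:%R (@tens M N).
Proof.
split=> [y a x x'|x a y y']; apply/eqP;
  rewrite -linearZ -linearD /= quotmod_piE opprD addrA;
  apply/asboolP=> S; apply; [left|right].
- by exists a, x, x', y.
- by exists a, x, y, y'.
Qed.
HB.instance Definition _ M N :=
  bilinear_isBilinear.Build A M N (tensor M N) *:%R *:%R (@tens M N)
    (@tens_bilinear M N).

Section Lift.
Variables (M N P : lmodType A) (b : {bilinear M -> N -> P}).

Definition tensor_lift (t : tensor M N) : P :=
  free_lift (fun xy => b xy.1 xy.2) (repr t).

Let lift0 z :
  z \in span (@tensor_relator M N) -> free_lift (fun xy => b xy.1 xy.2) z = 0.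
Proof.
move/asboolP=> /(_ (ker (free_lift (fun xy => b xy.1 xy.2)))) zker.
apply/eqP; apply: zker => g [] [a [x [y [u ->]]]]; rewrite unfold_in /ker;
  rewrite !linearB linearZ /= !free_liftU !scale1r /=.
  by rewrite linearPl -addrA -opprD subrr.
by rewrite linearPr -addrA -opprD subrr.
Qed.

Let lift_pi z : tensor_lift (quotmod_pi _ z) = free_lift (fun xy => b xy.1 xy.2) z.
Proof.
apply/eqP; rewrite -subr_eq0 -linearB; apply/eqP/lift0.
by rewrite -quotmod_piE quotmod_pi_repr.
Qed.

Lemma tensor_liftE x y : tensor_lift (tens x y) = b x y.
Proof. by rewrite lift_pi free_liftU scale1r. Qed.

Fact tensor_lift_is_linear : linear tensor_lift.
Proof.
move=> a s t; rewrite -[s]quotmod_pi_repr -[t]quotmod_pi_repr.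
by rewrite -linearZ -linearD !lift_pi linearP.
Qed.
HB.instance Definition _ :=
  GRing.isLinear.Build A (tensor M N) P *:%R tensor_lift tensor_lift_is_linear.

End Lift.

Section Map.
Variables (M M' N N' : lmodType A).
Variables (f : {linear M -> M'}) (g : {linear N -> N'}).

Definition tens_comp (x : M) (y : N) : tensor M' N' := tens (f x) (g y).

Fact tens_comp_bilinear : bilinear_for *:%R *:%R tens_comp.
Proof.
by split=> [y a x x'|x a y y']; rewrite /tens_comp linearP ?linearPl ?linearPr.
Qed.
HB.instance Definition _ :=
  bilinear_isBilinear.Build A M N (tensor M' N') *:%R *:%R tens_comp
    tens_comp_bilinear.

Definition tensor_map : {linear tensor M N -> tensor M' N'} :=
  tensor_lift tens_comp.

End Map.

Definition flat N : Prop :=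
  forall (M M' : lmodType A) (f : {linear M -> M'}),
    injective f -> injective (tensor_map f (idfun : {linear N -> N})).

End TensorProduct.

(* [restrict phi] is B seen as an A-module through [phi : A -> B]. *)
Definition restrict (A B : comNzRingType) (phi : {rmorphism A -> B}) : Type := B.

Section RestrictionOfScalars.
Variables (A B : comNzRingType) (phi : {rmorphism A -> B}).
Local Notation Bphi := (restrict phi).

HB.instance Definition _ := GRing.Zmodule.copy Bphi B.

Definition restrict_scale (a : A) (x : Bphi) : Bphi := phi a * (x : B).

Fact restrict_scaleA a b x :
  restrict_scale a (restrict_scale b x) = restrict_scale (a * b) x.
Proof. by rewrite /restrict_scale rmorphM mulrA. Qed.
Fact restrict_scale1 : left_id 1 restrict_scale.
Proof. by move=> x; rewrite /restrict_scale rmorph1 mul1r. Qed.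
Fact restrict_scaleDr : right_distributive restrict_scale +%R.
Proof. by move=> a x y; rewrite /restrict_scale mulrDr. Qed.
Fact restrict_scaleDl x : {morph restrict_scale^~ x : a b / a + b}.
Proof. by move=> a b; rewrite /restrict_scale rmorphD mulrDl. Qed.
HB.instance Definition _ := GRing.Zmodule_isLmodule.Build A Bphi
  restrict_scaleA restrict_scale1 restrict_scaleDr restrict_scaleDl.

Definition restrict_mul (x y : Bphi) : Bphi := (x : B) * (y : B).

Fact restrict_mul_bilinear : bilinear_for *:%R *:%R restrict_mul.
Proof.
split=> [y a x x'|x a y y'].
  by rewrite [LHS]mulrDl -[X in X + _]mulrA.
by rewrite [LHS]mulrDr [X in X + _]mulrCA.
Qed.
HB.instance Definition _ :=
  bilinear_isBilinear.Build A Bphi Bphi Bphi *:%R *:%R restrict_mul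
    restrict_mul_bilinear.

Definition mult_map : {linear tensor Bphi Bphi -> Bphi} :=
  tensor_lift restrict_mul.

Definition ring_epimorphism : Prop :=
  forall (C : comPzRingType) (alpha beta : {rmorphism B -> C}),
    alpha \o phi =1 beta \o phi -> alpha =1 beta.

Definition flat_epimorphism : Prop := ring_epimorphism /\ flat Bphi.

End RestrictionOfScalars.

(* The degrees <= 2 part of the standard free resolution of N, in which each
   free module is the one on the underlying set of the preceding kernel. *)
Section Tor.
Variable A : comNzRingType.
Implicit Types L M N F : lmodType A.

Definition syzygy M N (f : {linear M -> N}) :
    {linear {freeg (submod (ker f)) / A} -> M} :=
  free_lift (@submod_val A M (ker f)).

Definition resolution0 N : {linear {freeg N / A} -> N} := free_lift (@idfun N).
Definition resolution1 N := syzygy (resolution0 N).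
Definition resolution2 N := syzygy (resolution1 N).

Definition homology L M N (g : {linear L -> M}) (f : {linear M -> N}) : Type :=
  quotmod (preim (val : submod (ker f) -> M) (im g)).
HB.instance Definition _ L M N (g : {linear L -> M}) (f : {linear M -> N}) :=
  GRing.Lmodule.on (homology g f).

Definition Tor1 N F : lmodType A :=
  homology (tensor_map (resolution2 N) (idfun : {linear F -> F}))
           (tensor_map (resolution1 N) (idfun : {linear F -> F})).

End Tor.

Section InjectiveEnvelope.
Variable A : comNzRingType.
Implicit Types M N E : lmodType A.

Definition injective_module E : Prop :=
  forall M N (f : {linear M -> N}) (g : {linear M -> E}),
    injective f -> exists h : {linear N -> E}, forall x, h (f x) = g x.

Definition injective_envelope M E (i : {linear M -> E}) : Prop :=
  [/\ injective_module E, injective i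
    & forall S : submodClosed E, (exists2 y, y \in S & y != 0) ->
        exists2 x, x != 0 & i x \in S].

End InjectiveEnvelope.

(* Ideals of R are the submodules of [R^o]. *)
Section WModules.
Variable R : idomainType.
Implicit Types (I J : submodClosed R^o) (M E : lmodType R).

(* Every linear form on J is the multiplication by a unique scalar, i.e. the
   natural map R -> Hom(J, R) is bijective. *)
Definition GV_ideal J : Prop :=
  finitely_generated J /\
  forall f : {linear submod J -> R^o}, exists! r : R, forall x, f x = r *: val x.

Definition GV_torsion M : Prop :=
  forall x : M, exists2 J, GV_ideal J & forall a, a \in J -> a *: x = 0.

Definition GV_torsion_free M : Prop :=
  forall (x : M) J, GV_ideal J -> (forall a, a \in J -> a *: x = 0) -> x = 0.

(* M_w as a subset of E, for i : M -> E an injective envelope. *)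
Definition w_envelope M E (i : {linear M -> E}) (y : E) : Prop :=
  exists2 J, GV_ideal J & forall a, a \in J -> exists x, a *: y = i x.

(* Injective envelopes are unique up to isomorphism over M, so the choice of E
   is immaterial. *)
Definition w_module M : Prop :=
  GV_torsion_free M /\
  exists E (i : {linear M -> E}),
    injective_envelope i /\ forall y, w_envelope i y <-> exists x, y = i x.

Definition w_ideal I : Prop := w_module (submod I).

Definition w_maximal I : Prop :=
  [/\ w_ideal I, 1 \notin I
    & forall I', w_ideal I' -> 1 \notin I' ->
        {subset I <= I'} -> {subset I' <= I}].

Definition w_flat M : Prop := forall N : lmodType R, GV_torsion (Tor1 N M).

Definition w_epimorphism (B : comNzRingType) (phi : {rmorphism R -> B}) : Prop :=
  GV_torsion (submod (ker (mult_map phi))) /\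
  GV_torsion (quotmod (im (mult_map phi))).

Lemma GV_ideal_neq0 J : GV_ideal J -> exists2 a, a \in J & a != 0.
Proof.
case=> _ /(_ \0)[r [_ r_uniq]]; apply: contrapT => J0.
have valJ0 (x : submod J) : val x = 0.
  apply: contrapT => /eqP x0; apply: J0; exists (val x) => //; exact: submodP.
have rE s : r = s by apply: r_uniq => x; rewrite valJ0 scaler0.
by move: (rE 1) (oner_neq0 R) => <-; rewrite (rE 0) eqxx.
Qed.

Section Prime.
Variables (m : submodClosed R^o) (a : R).

Definition colon : {pred R^o} := fun x => a *: x \in m.
Fact colon_submod_closed : submod_closed colon.
Proof.
split=> [|c x y mx my].
  by change (a *: (0 : R^o) \in m); rewrite scaler0 rpred0.
change (a *: (c *: x + y) \in m); rewrite scalerDr rpredD //.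
by rewrite scalerA mulrC -scalerA rpredZ.
Qed.
HB.instance Definition _ :=
  GRing.isSubmodClosed.Build R R^o colon colon_submod_closed.

Definition colon_mul (x : submod colon) : submod m :=
  Submod (submodP x : a *: val x \in m).
Fact colon_mul_is_linear : linear colon_mul.
Proof.
move=> c x y; apply: val_inj; rewrite [RHS]linearP /=.
by rewrite linearP.
Qed.
HB.instance Definition _ :=
  GRing.isLinear.Build R (submod colon) (submod m) *:%R colon_mul
    colon_mul_is_linear.

Hypothesis a0 : a != 0.

Lemma w_ideal_colon : w_ideal m -> w_ideal colon.
Proof.
case=> _ [E [i [[injE inj_i ess_i] iw]]]; split.
  move=> x J /GV_ideal_neq0[c cJ c0] /(_ c cJ)/(congr1 val)/eqP.
  rewrite linearZ linear0 /= mulf_eq0 (negPf c0) /= => /eqP x0.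
  exact: val_inj.
have mI x : x \in m -> x \in colon by move=> ?; apply: rpredZ.
have inj_mul : injective colon_mul.
  by move=> x y /(congr1 val) xy; apply: val_inj; exact: (mulfI a0 xy).
exists E, (i \o colon_mul); split; first split=> //.
- exact: inj_comp.
- move=> S /ess_i[x x0 Sx].
  pose x' : submod colon := Submod (mI _ (submodP x)); exists x'.
    by apply: contra_neq x0 => /(congr1 val) x0; apply: val_inj.
  change (i (colon_mul x') \in S).
  have -> : colon_mul x' = a *: x by apply: val_inj.
  by rewrite linearZ; apply: rpredZ.
move=> y; split=> [[J GVJ Jy]|[x ->]]; last first.
  have /iw[J GVJ _] : exists z, i (colon_mul x) = i z by exists (colon_mul x).
  by exists J => // c _; exists (c *: x); rewrite linearZ.
have [z yz] : exists z, y = i z.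
  by apply/iw; exists J => // c /Jy[x ->]; exists (colon_mul x).
have div_a (c : submod J) : exists x : R, a * x = val c * val z.
  have [x] := Jy _ (submodP c); rewrite yz -linearZ /= => /inj_i/(congr1 val).
  by rewrite linearZ => eq; exists (val x).
pose f c : R^o := sval (cid (div_a c)).
have fE c : a * f c = val c * val z by rewrite /f; case: cid.
have f_lin : linear f.
  move=> k c d; apply: (mulfI a0); rewrite fE linearP [LHS]mulrDl [RHS]mulrDr.
  rewrite fE; congr (_ + _); change (k * val c * val z = a * (k * f c)).
  by rewrite mulrCA fE mulrA.
pose fL : {linear submod J -> R^o} :=
  HB.pack f (GRing.isLinear.Build _ _ _ _ f f_lin).
have [_ /(_ fL)[r [fr _]]] := GVJ.
have [c cJ c0] := GV_ideal_neq0 GVJ.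
have ar : a * r = val z.
  apply: (mulfI c0); have := fE (Submod cJ).
  have -> : f (Submod cJ) = r * c by exact: (fr (Submod cJ)).
  by move=> /= <-; rewrite mulrA mulrC.
have rI : (r : R^o) \in colon.
  by change (a * r \in m); rewrite ar; exact: submodP.
by exists (Submod rI); rewrite yz /=; congr (i _); apply: val_inj.
Qed.

End Prime.

Lemma w_maximal_prime I a b :
  w_maximal I -> a * b \in I -> a \in I \/ b \in I.
Proof.
case=> wI _ maxI abI; have [aI|aI] := boolP (a \in I); [by left | right].
have a0 : a != 0 by apply: contraNneq aI => ->; exact: rpred0.
apply: (maxI (colon I a) (w_ideal_colon a0 wI)) => //.
- by rewrite unfold_in /colon /GRing.scale /= mulr1.
- by move=> x Ix; apply: rpredZ.
Qed.

End WModules.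

Section Overrings.
Variable R : idomainType.
Local Notation K := {fraction R}.
Local Notation "x %:F" := (@FracField.tofrac R x).

Record overring := Overring {
  overring_pred :> subringClosed K;
  overring_frac : forall r : R, r%:F \in overring_pred }.

Record overring_type (T : overring) : Type :=
  OverringElt { overring_val : K; overring_valP : overring_val \in T }.

HB.instance Definition _ (T : overring) := [isSub for @overring_val T].
HB.instance Definition _ (T : overring) := [Choice of overring_type T by <:].
HB.instance Definition _ (T : overring) :=
  [SubChoice_isSubComNzRing of overring_type T by <:].

Section Inclusions.
Variables T T' : overring.

Definition overring_incl (r : R) : overring_type T :=
  OverringElt (overring_frac T r).
Fact overring_incl_is_zmod_morphism : zmod_morphism overring_incl.
Proof. by move=> x y; apply: val_inj; rewrite [RHS]rmorphB /= rmorphB. Qed.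
Fact overring_incl_is_monoid_morphism : monoid_morphism overring_incl.
Proof.
split=> [|x y]; apply: val_inj; first by rewrite [RHS]rmorph1 /= rmorph1.
by rewrite [RHS]rmorphM /= rmorphM.
Qed.
HB.instance Definition _ :=
  GRing.isZmodMorphism.Build R (overring_type T) overring_incl
    overring_incl_is_zmod_morphism.
HB.instance Definition _ :=
  GRing.isMonoidMorphism.Build R (overring_type T) overring_incl
    overring_incl_is_monoid_morphism.

Hypothesis sTT' : {subset T <= T'}.

Definition overring_widen (x : overring_type T) : overring_type T' :=
  OverringElt (sTT' (overring_valP x)).
Fact overring_widen_is_zmod_morphism : zmod_morphism overring_widen.
Proof. by move=> x y; apply: val_inj; rewrite [RHS]rmorphB; exact: (rmorphB val). Qed.
Fact overring_widen_is_monoid_morphism : monoid_morphism overring_widen.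
Proof.
split=> [|x y]; apply: val_inj; first by rewrite [RHS]rmorph1; exact: (rmorph1 val).
by rewrite [RHS]rmorphM; exact: (rmorphM val).
Qed.
HB.instance Definition _ :=
  GRing.isZmodMorphism.Build (overring_type T) (overring_type T') overring_widen
    overring_widen_is_zmod_morphism.
HB.instance Definition _ :=
  GRing.isMonoidMorphism.Build (overring_type T) (overring_type T')
    overring_widen overring_widen_is_monoid_morphism.

End Inclusions.

(* R itself, seen inside its fraction field. *)
Definition base_pred : {pred K} := fun x => `[< exists r : R, x = r%:F >].
Fact base_subring_closed : subring_closed base_pred.
Proof.
split=> [|_ _ /asboolP[x ->] /asboolP[y ->]|_ _ /asboolP[x ->] /asboolP[y ->]];
  apply/asboolP.
- by exists 1; rewrite rmorph1.
- by exists (x - y); rewrite rmorphB.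
- by exists (x * y); rewrite rmorphM.
Qed.
HB.instance Definition _ :=
  GRing.isSubringClosed.Build K base_pred base_subring_closed.
Fact base_frac (r : R) : r%:F \in base_pred.
Proof. by apply/asboolP; exists r. Qed.
Definition base : overring := Overring base_frac.

Record wMax := WMax { wMax_ideal :> submodClosed R^o;
                      wMaxP : w_maximal wMax_ideal }.

Section Localization.
Variables (T : overring) (m : wMax).

(* T_m, identified with its image {t / s : t in T, s in R \ m} in K. *)
Definition localization_pred : {pred K} :=
  fun x => `[< exists t (s : R), [/\ t \in T, s \notin m & x = t / s%:F] >].

Let m_neq0 (s : R) : s \notin m -> s%:F != 0.
Proof. by move=> ms; rewrite tofrac_eq0; apply: contraNneq ms => ->; apply: rpred0. Qed.

Let m_mul (s t : R) : s \notin m -> t \notin m -> s * t \notin m.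
Proof.
by move=> sm tm; apply/negP => /(w_maximal_prime (wMaxP m))[]; apply/negP.
Qed.

Let m_one : (1 : R) \notin m. Proof. by case: (wMaxP m). Qed.

Fact localization_subring_closed : subring_closed localization_pred.
Proof.
split=> [|_ _ /asboolP[x [s [Tx ms ->]]] /asboolP[y [t [Ty mt ->]]]
         |_ _ /asboolP[x [s [Tx ms ->]]] /asboolP[y [t [Ty mt ->]]]];
  apply/asboolP.
- by exists 1, 1; rewrite rpred1 rmorph1 divr1.
- exists (x * t%:F - y * s%:F), (s * t); split; last 1 first.
  + by rewrite rmorphM -[- (y / _)]mulNr addf_div ?m_neq0 // mulNr.
  + by apply: rpredB; apply: rpredM => //; apply: overring_frac.
  + exact: m_mul.
- exists (x * y), (s * t); split; [exact: rpredM | exact: m_mul |].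
  by rewrite rmorphM mulf_div.
Qed.
HB.instance Definition _ :=
  GRing.isSubringClosed.Build K localization_pred localization_subring_closed.

Fact localization_frac (r : R) : r%:F \in localization_pred.
Proof.
by apply/asboolP; exists r%:F, 1; rewrite rmorph1 divr1 overring_frac.
Qed.
Definition localization : overring := Overring localization_frac.

End Localization.

Fact localization_subset (T : overring) (m : wMax) :
  {subset localization base m <= localization T m}.
Proof.
move=> _ /asboolP[_ [s [/asboolP[r ->] ms ->]]]; apply/asboolP.
by exists r%:F, s; rewrite overring_frac.
Qed.

Definition localized_incl (T : overring) (m : wMax) :
    {rmorphism overring_type (localization base m) ->
               overring_type (localization T m)} :=
  overring_widen (@localization_subset T m).

End Overrings.

Section PvMD.
Variable R : idomainType.
Local Notation K := {fraction R}.
Local Notation "x %:F" := (@FracField.tofrac R x).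
Implicit Types I : submodClosed R^o.

Definition fraction_module : lmodType R :=
  restrict (@FracField.tofrac R : {rmorphism R -> K}).

Definition in_inverse I (x : K) : Prop :=
  forall a, a \in I -> exists r : R, a%:F * x = r%:F.

Definition mul_inverse I : {pred fraction_module} :=
  span (fun z : fraction_module => exists (a : R) (x : K),
          [/\ a \in I, in_inverse I x & z = a%:F * x :> K]).
HB.instance Definition _ I := GRing.SubmodClosed.on (mul_inverse I).

(* K is an injective envelope of each of its nonzero R-submodules, so (I I^-1)_w
   is computed inside K. *)
Definition w_invertible I : Prop :=
  forall x : fraction_module,
    w_envelope (val : submod (mul_inverse I) -> fraction_module) x
    <-> exists r : R, x = r%:F.

Definition PvMD : Prop :=
  forall I, finitely_generated I -> (exists2 a, a \in I & a != 0) ->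
    w_invertible I.

End PvMD.

(* Main.v *)
(* Both conditions say that R_m is a valuation ring for every m in w-Max(R).
   For a PvMD, the ideal (a, b)(a, b)^-1 contains a GV-ideal, hence is not inside
   m, so one of a, b divides the other in R_m; conversely, if every R_m is a
   valuation ring then I I^-1 lies in no m, and by Zorn it contains a GV-ideal.
   Over a valuation ring T_m is a directed union of cyclic modules, hence flat.
   If B is a flat overring of R_m and x is in B, then (R_m : x)B = B; applied to
   R_m[x] and R_m[1/x] with x, 1/x outside R_m, this writes 1 as a polynomial in
   x and as a polynomial in 1/x, both with coefficients in m R_m, and eliminating
   leading terms leads to a contradiction.
   Finally, an element z of M (x) T satisfies s z = x (x) t for some s outside m,
   which makes GV-torsion in Tor_1(N, T) and ker mu visible m by m. *)
From HB Require Import structures.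
From mathcomp Require Import all_boot all_algebra.
From mathcomp Require Import boolp classical_sets.
From mathcomp Require Import freeg.
Require Import Defs.

Set Implicit Arguments.
Unset Strict Implicit.
Unset Printing Implicit Defensive.

Import GRing.Theory.
Local Open Scope ring_scope.

(** * Submodules given by predicates, and induction on spans *)

Section Spans.
Variables (A : nzRingType) (M : lmodType A).

Section Comprehension.
Variable P : M -> Prop.
Hypotheses (P0 : P 0) (PZD : forall a x y, P x -> P y -> P (a *: x + y)).

(** The closure proofs are arguments of the predicate, so that the term itself carries what its
    [submodClosed] instance needs. *)
Definition submod_pred (_ : P 0)
  (_ : forall a x y, P x -> P y -> P (a *: x + y)) : {pred M} :=
  fun x => `[< P x >].

Fact submod_pred_closed : submod_closed (submod_pred P0 PZD).
Proof.
split=> [|a x y /asboolP Px /asboolP Py]; apply/asboolP; first exact: P0.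
exact: PZD.
Qed.
HB.instance Definition _ :=
  GRing.isSubmodClosed.Build A M (submod_pred P0 PZD) submod_pred_closed.

End Comprehension.

Lemma span_ind (G P : M -> Prop) :
  P 0 -> (forall a x y, P x -> P y -> P (a *: x + y)) ->
  (forall x, G x -> P x) -> forall x, x \in span G -> P x.
Proof.
move=> P0 PZD GP x /asboolP xG.
by apply/asboolP/(xG (submod_pred P0 PZD)) => g /GP ?; apply/asboolP.
Qed.

Lemma mem_span (G : M -> Prop) x : G x -> x \in span G.
Proof. by move=> Gx; apply/asboolP=> S; apply. Qed.

Lemma span_min (G : M -> Prop) (S : submodClosed M) :
  (forall g, G g -> g \in S) -> {subset span G <= S}.
Proof. by move=> GS x /asboolP; apply. Qed.

End Spans.

(** * Induction on tensors and vanishing of elementary tensors *)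

Section Tensors.
Variable A : comNzRingType.
Implicit Types M N P : lmodType A.

Lemma mem_preim M N (f : {linear M -> N}) (S : submodClosed N) x :
  (x \in preim f S) = (f x \in S).
Proof. by []. Qed.

Lemma tensZl M N a (x : M) (y : N) : tens (a *: x) y = a *: tens x y.
Proof. by rewrite linearZl. Qed.

Lemma tensZr M N a (x : M) (y : N) : tens x (a *: y) = a *: tens x y.
Proof. by rewrite linearZr. Qed.

Lemma tensor_ind M N (Q : tensor M N -> Prop) :
  (forall x y, Q (tens x y)) -> (forall u v, Q u -> Q v -> Q (u + v)) ->
  forall u, Q u.
Proof.
move=> Qtens QD u; rewrite -[u]quotmod_pi_repr -[repr u]freeg_sumE.
rewrite raddf_sum /=; elim/big_ind: _ => [||[x y] _]; last 1 first.
- rewrite -[X in << X *g _ >>]mulr1.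
  have -> k : << k * 1 *g (x, y) >> = k *: << (x, y) >> :> {freeg (M * N)%type / A}.
    apply/eqP/freeg_eqP => z; rewrite -[RHS]/(coeff z (fgscale _ _)).
    by rewrite coeff_fgscale !coeffU mulrA.
  by rewrite linearZ; have := Qtens (coeff (x, y) (repr u) *: x) y;
     rewrite tensZl.
- by have := Qtens 0 0; rewrite linear0l.
- exact: QD.
Qed.

Lemma tensor_mapE M M' N N' (f : {linear M -> M'}) (g : {linear N -> N'}) x y :
  tensor_map f g (tens x y) = tens (f x) (g y).
Proof. exact: tensor_liftE. Qed.

Lemma relator_span M N (x : M) (y : N) : tens x y = 0 ->
  << (x, y) >> \in span (@tensor_relator A M N).
Proof.
move=> xy0; rewrite -[X in X \in _]subr0 -quotmod_piE; apply/eqP.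
by rewrite [LHS]xy0 linear0.
Qed.

(* The values of g need only be bilinear up to S, which spares a quotient. *)
Lemma tens_eq0_mem M N P (g : M -> N -> P) (S : submodClosed P) :
    (forall a x x' y, g (a *: x + x') y - a *: g x y - g x' y \in S) ->
    (forall a x y y', g x (a *: y + y') - a *: g x y - g x y' \in S) ->
  forall x y, tens x y = 0 -> g x y \in S.
Proof.
move=> gl gr x y /relator_span xy.
suff : << (x, y) >> \in preim (free_lift (fun z => g z.1 z.2)) S.
  by rewrite mem_preim /= free_liftU scale1r.
apply: span_min xy => _ [] [a [u [v [w ->]]]];
    rewrite mem_preim !linearB linearZ /= !free_liftU !scale1r;
  [exact: gl | exact: gr].
Qed.

Lemma tens_eq0 M N P (g : M -> N -> P) : bilinear_for *:%R *:%R g ->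
  forall x y, tens x y = 0 -> g x y = 0.
Proof.
move=> [gl gr] x y xy0; apply/eqP.
(* [ker idfun] is the zero submodule of P. *)
apply: (@tens_eq0_mem M N P g (ker idfun) _ _ x y xy0) => [a u v w|a u v w].
  by rewrite unfold_in /ker /= gl -addrA -opprD subrr.
by rewrite unfold_in /ker /= gr -addrA -opprD subrr.
Qed.

End Tensors.

(** * Flatness of torsion-free directed unions of cyclic modules *)

Section DirectedFlat.
Variables (A : comNzRingType) (N : lmodType A).
Hypothesis torsion_free : forall (a : A) (x : N), a *: x = 0 -> a = 0 \/ x = 0.
Hypothesis directed : forall x y : N, exists z a b, x = a *: z /\ y = b *: z.

Let divides (z x : N) := exists a, x = a *: z.
(** The quotient x / z, unique for nonzero z by torsion-freeness. The default 0 makes it total, so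
    that it defines a map on all generators of a free module. *)
Let ratio (z x : N) : A :=
  if pselect (divides z x) is left zx then sval (cid zx) else 0.

Let ratioK z x : divides z x -> ratio z x *: z = x.
Proof.
by move=> zx; rewrite /ratio; case: pselect => // {}zx; case: cid.
Qed.

Let ratio_uniq z x a : z != 0 -> x = a *: z -> ratio z x = a.
Proof.
move=> z0 xa; apply/eqP; rewrite -subr_eq0; apply/eqP.
have [|//|z_eq0] := torsion_free (a := ratio z x - a) (x := z).
  by rewrite scalerBl ratioK -?xa ?subrr //; exists a.
by rewrite z_eq0 eqxx in z0.
Qed.

Let divides_trans y x z : divides x y -> divides y z -> divides x z.
Proof. by move=> [a ->] [b ->]; exists (b * a); rewrite scalerA. Qed.

Let directed_neq0 x y : x != 0 -> exists z, [/\ z != 0, divides z x & divides z y].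
Proof.
move=> x0; have [z [a [b [xa yb]]]] := directed x y; exists z; split.
- by apply: contraNneq x0 => z0; rewrite xa z0 scaler0.
- by exists a.
- by exists b.
Qed.

(* N is the directed union of its cyclic submodules Az, so a relation
   x (x) y = 0 already holds in some M (x) Az = M. *)
Lemma tens_eq0_directed (M : lmodType A) (x : M) (y : N) : tens x y = 0 ->
  exists z a, y = a *: z /\ a *: x = 0.
Proof.
have [->|y0] := eqVneq y 0.
  by move=> _; exists 0, 0; rewrite !scale0r.
pose phi z : {linear {freeg (M * N)%type / A} -> M} :=
  free_lift (fun p => ratio z p.2 *: p.1).
(* P asks that [phi z'] kill w for every z' far enough in the divisibility order. Each relator is
   killed only once z' divides its entries, and directedness keeps the condition stable under
   sums. *)
pose P w := exists2 z, z != 0 & forall z', z' != 0 -> divides z' z -> phi z' w = 0.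
have P0 : P 0 by exists y => // z' _ _; rewrite linear0.
have PZD a u v : P u -> P v -> P (a *: u + v).
  move=> [z z0 uz] [t t0 vt]; have [s [s0 sz st]] := directed_neq0 t z0.
  exists s => // r r0 rs; rewrite linearP uz ?vt ?scaler0 ?addr0 //;
    exact: divides_trans rs _.
move/relator_span/(span_ind P0 PZD)=> xy; case: xy => [w [] | t t0 yt].
- move=> [a [u [u' [v ->]]]]; have [z [z0 _ zv]] := directed_neq0 v y0.
  exists z => // s s0 sz; rewrite /phi !linearB linearZ /= !free_liftU !scale1r /=.
  by rewrite scalerDr !scalerA mulrC -addrA -opprD subrr.
- move=> [a [u [v [v' ->]]]]; have [r [r0 _ rv]] := directed_neq0 v y0.
  have [z [z0 zr zv']] := directed_neq0 v' r0.
  exists z => // s s0 sz; rewrite /phi !linearB linearZ /= !free_liftU !scale1r /=.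
  have [sv sv'] : divides s v /\ divides s v'.
    by split; apply: divides_trans sz _ => //; apply: divides_trans zr rv.
  rewrite (@ratio_uniq s (a *: v + v') (a * ratio s v + ratio s v')) //.
    by rewrite scalerDl scalerA -addrA -opprD subrr.
  by rewrite scalerDl -scalerA !ratioK.
have [z [z0 zt zy]] := directed_neq0 y t0.
exists z, (ratio z y); rewrite ratioK //; split=> //.
by have := yt z z0 zt; rewrite /phi /= free_liftU scale1r.
Qed.

Lemma tensor_directed (M : lmodType A) (u : tensor M N) :
  exists x y, u = tens x y.
Proof.
elim/tensor_ind: u => [x y|_ _ [x [y ->]] [x' [y' ->]]]; first by exists x, y.
have [z [a [b [-> ->]]]] := directed y y'.
by exists (a *: x + b *: x'), z; rewrite !tensZr -!tensZl linearDl.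
Qed.

(** Every tensor is elementary. If f(x) (x) y = 0, then y = a z with a f(x) = 0, so a x = 0 by
    injectivity and x (x) y = a x (x) z = 0. *)
Lemma flat_directed : flat N.
Proof.
move=> M M' f f_inj; apply: raddf_inj => u.
have [x [y ->]] := tensor_directed u.
rewrite [X in X = 0 -> _]tensor_mapE /= => /tens_eq0_directed[z [a [-> afx]]].
rewrite tensZr -tensZl.
suff -> : a *: x = 0 by rewrite linear0l.
by apply: f_inj; rewrite linearZ linear0.
Qed.

End DirectedFlat.

(** * Flat rings of fractions are epimorphic *)

Section FlatRingOfFractions.
Variables (A B : comNzRingType) (phi : {rmorphism A -> B}).
Local Notation Bphi := (restrict phi).
Hypothesis common_denominator : forall x : B, exists d a,
  (forall y : B, phi d * y = 0 -> y = 0) /\ phi d * x = phi a.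
Hypothesis flatB : flat Bphi.

(** The ideal (A : x)B, written as the A-span of all B-multiples of elements of (A : x). *)
Definition denominator_ideal (x : B) : {pred Bphi} :=
  span (fun z : Bphi => exists c y, (exists a, phi c * x = phi a) /\ z = phi c * y).

(* With x = a/d, multiplication by a embeds A/(A : x) into A/dA, and becomes
   zero after tensoring with B since a = dx there; so B/(A : x)B = 0. *)
Lemma one_in_denominator_ideal (x : B) : (1 : Bphi) \in denominator_ideal x.
Proof.
have [d [a [d_reg dx]]] := common_denominator x.
pose dA := span (fun c : A^o => c = d).
pose abar : quotmod dA := quotmod_pi dA (a : A^o).
pose M := submod (span (fun y => y = abar)).
have dA_dvd (c : A^o) : c \in dA -> exists k, c = k * d.
  apply: (span_ind (P := fun c : A^o => exists k, c = k * d))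
    => [|k _ _ [c1 ->] [c2 ->]|_ ->].
  - by exists 0; rewrite mul0r.
  - by exists (k * c1 + c2); rewrite mulrDl -mulrA.
  - by exists 1; rewrite mul1r.
have ratio_ex (m : M) : exists r : A, val m = r *: abar.
  have := submodP m; set v := submod_val m => mv.
  change (exists r : A, v = r *: abar); move: mv.
  apply: (span_ind (P := fun v => exists r : A, v = r *: abar))
    => [|k _ _ [c1 ->] [c2 ->]|_ ->].
  - by exists 0; rewrite scale0r.
  - by exists (k * c1 + c2); rewrite scalerDl scalerA.
  - by exists 1; rewrite scale1r.
(* A mere choice of coefficients, linear only up to annihilators of [abar]; the map (m, y) to r m y
   is thus bilinear modulo [denominator_ideal x]. *)
pose r m := sval (cid (ratio_ex m)).
have rE m : val m = r m *: abar by rewrite /r; case: cid.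
(* If e a = k d in A, then d (e x) = d k in B, and cancelling d gives e x = k: e lies in (A : x). *)
have ann_abar e y : e *: abar = 0 -> (phi e * y : Bphi) \in denominator_ideal x.
  rewrite -linearZ -[0](linear0 (quotmod_pi dA)) => /eqP.
  rewrite quotmod_piE subr0 => /dA_dvd[k ek].
  apply: mem_span; exists e, y; split=> //; exists k.
  apply/eqP; rewrite -subr_eq0; apply/eqP/d_reg.
  rewrite mulrBr mulrCA dx -!rmorphM -[e * a]/(e *: (a : A^o)) ek mulrC.
  by rewrite rmorphM subrr.
pose m0 : M := Submod (mem_span (erefl abar)).
have m01 : tens m0 (1 : Bphi) = 0.
  apply: (flatB (f := (val : M -> _)) val_inj).
  rewrite linear0 [LHS]tensor_mapE /=.
  have -> : abar = a *: quotmod_pi dA (1 : A^o).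
    by rewrite -linearZ; congr quotmod_pi; exact/esym/mulr1.
  rewrite tensZl -tensZr.
  have -> : a *: (1 : Bphi) = d *: (x : Bphi).
    by rewrite [LHS]mulr1 -dx.
  rewrite tensZr -tensZl -linearZ.
  have -> : d *: (1 : A^o) = d :> A^o by exact: mulr1.
  rewrite [X in tens X _](_ : _ = 0) ?linear0l //.
  rewrite -(linear0 (quotmod_pi dA)); apply/eqP; rewrite quotmod_piE subr0.
  exact: mem_span.
have r0 : (r m0 *: (1 : Bphi)) \in denominator_ideal x.
  apply: (tens_eq0_mem (g := fun m y => r m *: (y : Bphi)) _ _ m01) => [c m m' y|c m y y'].
    rewrite scalerA -!scalerBl; apply: ann_abar.
    rewrite !scalerBl -scalerA -!rE linearP.
    by rewrite -addrA -opprD subrr.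
  by rewrite scalerDr !scalerA mulrC -addrA -opprD subrr rpred0.
(* Both 1 and r m0 are coefficients of the generator [abar], so 1 - r m0 annihilates it. *)
rewrite -(subrK (r m0 *: (1 : Bphi)) 1) rpredD //.
rewrite -[X in X - _](scale1r (1 : Bphi)) -scalerBl; apply: ann_abar.
by rewrite scalerBl -rE scale1r subrr.
Qed.

(** If c x comes from A for some c in A, then alpha and beta agree on c and on c x, so the image of
    c kills alpha x - beta x. Such c generate the unit ideal of B. *)
Lemma flat_fractions_epi : ring_epimorphism phi.
Proof.
move=> C alpha beta eq_phi x; apply/eqP; rewrite -subr_eq0; apply/eqP.
suff zker (z : Bphi) : z \in denominator_ideal x -> beta z * (alpha x - beta x) = 0.
  by have := zker _ (one_in_denominator_ideal x); rewrite rmorph1 mul1r.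
have eqphi c : alpha (phi c) = beta (phi c) by exact: eq_phi.
apply: (span_ind (P := fun z : Bphi => beta z * (alpha x - beta x) = 0))
  => [|c u v u0 v0|_ [c [y [[a cx] ->]]]].
- by rewrite rmorph0 mul0r.
- by rewrite rmorphD mulrDl v0 addr0 rmorphM -mulrA u0 mulr0.
- rewrite rmorphM mulrAC mulrBr -{1}eqphi -!rmorphM cx eqphi.
  by rewrite subrr mul0r.
Qed.

(** Clearing denominators gives d u = 1 (x) d mu(u) with d regular on B. If mu(u) = 0 then d u = 0,
    and flatness carries the injectivity of multiplication by d from B to B (x) B. *)
Lemma flat_fractions_mult_bij : bijective (mult_map phi).
Proof.
have multE (x y : Bphi) : mult_map phi (tens x y) = (x : B) * (y : B) :> B.
  exact: (tensor_liftE (@restrict_mul A B phi)).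
have collect (u : tensor Bphi Bphi) : exists d : A,
  (forall y : B, phi d * y = 0 -> y = 0) /\ d *: u = tens (1 : Bphi) (d *: mult_map phi u).
  elim/tensor_ind: u => [x y|u v [d [d_reg du]] [e [e_reg ev]]].
    have [d [a [d_reg dx]]] := common_denominator x; exists d; split=> //.
    rewrite -tensZl.
    have -> : d *: x = a *: (1 : Bphi) by rewrite [LHS]dx [RHS]mulr1.
    rewrite tensZl -tensZr; congr tens.
    by rewrite [LHS](congr1 ( *%R^~ y) (esym dx)) -mulrA multE.
  exists (d * e); split=> [y|].
    by rewrite rmorphM -mulrA => /d_reg/e_reg.
  rewrite [mult_map phi _]linearD !scalerDr linearDr; congr (_ + _).
    by rewrite mulrC -!scalerA du -tensZr.
  by rewrite -!scalerA ev -tensZr.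
have mult_inj : injective (mult_map phi).
  apply: raddf_inj => u; have [d [d_reg du]] := collect u; move=> mu0.
  rewrite [mult_map phi u]mu0 scaler0 linear0r in du.
  pose f : {linear Bphi -> Bphi} := d \*: idfun.
  have f_inj : injective f.
    by apply: raddf_inj => y; exact: d_reg.
  apply: (flatB f_inj); rewrite linear0.
  rewrite -[RHS]du; elim/tensor_ind: u {du mu0} => [x y|u v eu ev].
    by rewrite [LHS]tensor_mapE /= tensZl.
  by rewrite linearD eu ev scalerDr.
exists (fun y : Bphi => tens (1 : Bphi) y) => [u|y].
  by apply: mult_inj; rewrite multE mul1r.
by rewrite multE mul1r.
Qed.
End FlatRingOfFractions.

(** * Zorn's lemma above a given set *)

Section ZornAbove.
Variables (T : Type) (Q : set (set T)) (S0 : set T).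

Lemma Zorn_above : Q S0 ->
    (forall F : set (set T), (exists X, F X) -> (forall X, F X -> Q X) ->
      total_on F subset -> Q (fun x => exists2 X, F X & X x)) ->
  exists S : set T, [/\ Q S, subset S0 S
    & forall S' : set T, Q S' -> subset S S' -> subset S' S].
Proof.
(* Zorn runs on the sets X whose union with S0 satisfies Q; the empty chain, which [Qchain] leaves
   out, is then settled by [QS0]. *)
move=> QS0 Qchain; have [F FQ totF|A [QA maxA]] := Zorn_bigcup (P := fun X => Q (S0 `|` X)%classic).
  have [[X0 FX0]|F0] := pselect (exists X, F X); last first.
    have -> : (\bigcup_(X in F) X)%classic = set0.
      by apply/seteqP; split=> // x [X FX]; case: F0; exists X.
    by rewrite setU0.
  have -> : (S0 `|` \bigcup_(X in F) X)%classic =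
      (fun x => exists2 Y, (exists2 X, F X & Y = (S0 `|` X)%classic) & Y x).
    apply/seteqP; split=> [x [S0x|[X FX Xx]]|x [_ [X FX ->] [S0x|Xx]]].
    - by exists (S0 `|` X0)%classic; [exists X0 | left].
    - by exists (S0 `|` X)%classic; [exists X | right].
    - by left.
    - by right; exists X.
  apply: Qchain => [|_ [X FX ->]|_ _ [X FX ->] [Y FY ->]].
  - by exists (S0 `|` X0)%classic, X0.
  - exact: FQ.
  - by case: (totF X Y FX FY) => ?; [left|right]; exact: setUS.
exists (S0 `|` A)%classic; split=> // S' QS' AS' x S'x.
apply: contrapT => Ax; apply: (maxA S'); last first.
  have -> // : (S0 `|` S')%classic = S'.
  by apply/seteqP; split=> [y []//|y]; [move=> ?; apply: AS'; left | right].
split=> [|AS]; first by move=> y Ay; apply: AS'; right.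
by apply: Ax; right; exact: AS.
Qed.

(** Serves to show that the union of a chain of ideals without GV-families has none either, as such
    families are finite. *)
Lemma chain_finite (F : set (set T)) : (exists X, F X) -> total_on F subset ->
  forall (U : eqType) (h : U -> T) (s : seq U),
    (forall a, a \in s -> exists2 X, F X & X (h a)) ->
  exists2 X, F X & forall a, a \in s -> X (h a).
Proof.
move=> [X0 FX0] totF U h; elim=> [|a s IHs] sF; first by exists X0.
have [|X FX Xs] := IHs; first by move=> b bs; apply: sF; rewrite inE bs orbT.
have [|Y FY Ya] := sF a; first exact: mem_head.
have [XY|YX] := totF X Y FX FY.
  by exists Y => // b; rewrite inE => /predU1P[-> //|/Xs/XY].
by exists X => // b; rewrite inE => /predU1P[->|/Xs//]; exact: YX.
Qed.

End ZornAbove.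

(** * Injectivity of the quotient field *)

Section FractionInjective.
Variable R : idomainType.
Local Notation K := {fraction R}.
Local Notation "x %:F" := (@FracField.tofrac R x).

Lemma fraction_scaleE (a : R) (x : fraction_module R) :
  a *: x = a%:F * (x : K) :> K.
Proof. by []. Qed.

Lemma tofrac_inj : injective (@FracField.tofrac R).
Proof. by move=> a b /eqP; rewrite tofrac_eq => /eqP. Qed.

Lemma fractionP (x : K) : exists (a b : R), b != 0 /\ x = a%:F / b%:F.
Proof.
elim/quotW: x => x; exists (frac x).1, (frac x).2; split; first exact: denom_ratioP.
unlock FracField.tofrac; rewrite -[_^-1]FracField.pi_inv -[RHS]FracField.pi_mul.
rewrite /FracField.mulf /FracField.invf !numden_Ratio ?oner_eq0 ?denom_ratioP //.
by rewrite mulr1 mul1r Ratio_numden.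
Qed.

(* Zorn on the graphs of partial extensions: a divisible torsion-free target
   allows an extension to one more element. *)
Lemma fraction_injective : injective_module (fraction_module R).
Proof.
move=> M N f g f_inj; set F := fraction_module R.
pose Q (G : N * F -> Prop) := [/\ G 0, forall a u v, G u -> G v -> G (a *: u + v)
   & forall k, G (0, k) -> k = 0].
have [||G [[G0 GZD Gfun] fgG Gmax]] :=
    Zorn_above (Q := Q) (S0 := fun u => exists x, u = (f x, g x)).
- split=> [|a _ _ [x ->] [y ->]|k [x [/esym fx0 ->]]].
  + by exists 0; rewrite !linear0.
  + by exists (a *: x + y); rewrite !linearP.
  + by move: fx0; rewrite -(linear0 f) => /f_inj ->; rewrite linear0.
- move=> C [X0 CX0] CQ totC; split=> [|a u v [X CX Xu] [Y CY Yv]|k [X CX X0k]].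
  + by exists X0 => //; case: (CQ _ CX0).
  + have [XY|YX] := totC X Y CX CY.
      by exists Y => //; have [_ YZD _] := CQ _ CY; apply: YZD => //; exact: XY.
    by exists X => //; have [_ XZD _] := CQ _ CX; apply: XZD => //; exact: YX.
  + by have [_ _] := CQ _ CX; apply.
have GB u v : G u -> G v -> G (u - v).
  by move=> Gu Gv; rewrite addrC -scaleN1r; exact: GZD.
have GZ a u : G u -> G (a *: u) by move=> Gu; rewrite -[_ *: _]addr0; exact: GZD.
have G_uniq n k k' : G (n, k) -> G (n, k') -> k = k'.
  move=> Gk Gk'; apply/eqP; rewrite -subr_eq0; apply/eqP/Gfun.
  have : G (n - n, k - k') by exact: GB Gk Gk'.
  by rewrite subrr.
have Gtot n : exists k, G (n, k).
  (* The value v to assign to n: if some nonzero multiple a n already has a value k, then v = k / a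
     is forced. Otherwise only the zero multiple lies in the domain and v = 0 will do. *)
  have [v vP] : exists v : F, forall a k, G (a *: n, k) -> k = a *: v.
    have [[a [a0 [k Gk]]]|no_a] :=
        pselect (exists a : R, a != 0 /\ exists k, G (a *: n, k)).
      exists ((k : K) / a%:F : K) => b l Gl.
      have aF0 : a%:F != 0 by rewrite tofrac_eq0.
      apply: (mulfI aF0); rewrite fraction_scaleE [RHS]mulrCA [_ * (_ / _)]mulrCA.
      rewrite divff // mulr1; apply: (G_uniq (a *: (b *: n))); first exact: GZ (_, _) Gl.
      by rewrite scalerA mulrC -scalerA; exact: GZ (_, _) Gk.
    exists 0 => a k Gk; rewrite scaler0; have [a0|a0] := eqVneq a 0.
      by move: Gk; rewrite a0 scale0r => /Gfun.
    by case: no_a; exists a; split=> //; exists k.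
  pose G' u := exists d r, G d /\ u = d + r *: (n, v).
  exists v; apply: (Gmax G') => [|u Gu|]; last 1 first.
  - by exists 0, 1; rewrite add0r scale1r.
  - split=> [|a _ _ [d [r [Gd ->]]] [e [s [Ge ->]]]|k [[d k'] [r [Gd [dn ->]]]]].
    + by exists 0, 0; rewrite scale0r addr0.
    + exists (a *: d + e), (a * r + s); split; first exact: GZD.
      by rewrite scalerDr scalerDl scalerA addrACA.
    + apply/eqP; rewrite addr_eq0 -scaleNr; apply/eqP/vP.
      by move/esym/eqP: dn; rewrite addr_eq0 => /eqP dn; rewrite scaleNr -dn.
  - by exists u, 0; rewrite scale0r addr0.
pose h n : F := sval (cid (Gtot n)).
have hG n : G (n, h n) by rewrite /h; case: cid.
have h_lin : linear h.
  move=> a x y; apply: (G_uniq (a *: x + y)) => //.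
  exact: (GZD a (x, h x) (y, h y)).
pose hL : {linear N -> F} := HB.pack h (GRing.isLinear.Build _ _ _ _ h h_lin).
exists hL => x /=.
by apply: (G_uniq (f x)) => //; apply: fgG; exists x.
Qed.

End FractionInjective.

(** * GV-ideals, w-ideals and maximal w-ideals *)

Section GVFamilies.
Variable R : idomainType.
Local Notation K := {fraction R}.
Local Notation "x %:F" := (@FracField.tofrac R x).
Implicit Types (I J : submodClosed R^o) (s t : seq R) (x y : K).

(* The ideal generated by s is nonzero with inverse R, i.e. a GV-ideal. *)
Definition gv_family s : Prop :=
  (exists2 a, a \in s & a != 0) /\
  forall x, (forall a, a \in s -> a%:F * x \in @base_pred R) -> x \in @base_pred R.

Definition contains_gv I : Prop :=
  exists2 s, gv_family s & forall a, a \in s -> a \in I.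

Lemma idealMl I (a b : R) : (b : R^o) \in I -> (a * b : R^o) \in I.
Proof. exact: (@rpredZ _ _ I a b). Qed.

Lemma tofrac_base (r : R) : r%:F \in @base_pred R.
Proof. by apply/asboolP; exists r. Qed.

Lemma base_predM (r : R) x : x \in @base_pred R -> r%:F * x \in @base_pred R.
Proof. by move=> ?; apply: rpredM => //; exact: tofrac_base. Qed.

(** Multiplication by x is a linear form on J, hence multiplication by some r in R; comparing at a
    nonzero element of J gives x = r. *)
Lemma GV_ideal_base J x : GV_ideal J ->
  (forall a, a \in J -> a%:F * x \in @base_pred R) -> x \in @base_pred R.
Proof.
move=> GVJ Jx; have [a aJ a0] := GV_ideal_neq0 GVJ; case: GVJ => _ homJ.
have f_ex (c : submod J) : exists r : R^o, (val c : R)%:F * x = r%:F.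
  exact/asboolP/Jx/submodP.
pose f c := sval (cid (f_ex c)).
have fE c : (f c : R)%:F = (val c : R)%:F * x by rewrite /f; case: cid.
have f_lin : linear f.
  move=> k c d; apply: (@tofrac_inj R).
  transitivity (k%:F * (f c : R)%:F + (f d : R)%:F); last by rewrite -rmorphM -rmorphD.
  rewrite !fE mulrA -mulrDl -rmorphM -rmorphD; congr (_%:F * x).
pose fL : {linear submod J -> R^o} := HB.pack f (GRing.isLinear.Build _ _ _ _ f f_lin).
have [r [fr _]] := homJ fL.
apply/asboolP; exists r; apply: (@mulfI _ a%:F); first by rewrite tofrac_eq0.
rewrite -[LHS](fE (Submod aJ)) -rmorphM mulrC; congr (_%:F).
exact: (fr (Submod aJ)).
Qed.

Lemma GV_ideal_contains_gv J : GV_ideal J -> contains_gv J.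
Proof.
move=> GVJ; have [a aJ a0] := GV_ideal_neq0 GVJ.
have [[n [g gJ]] _] := GVJ; exists [seq (g i : R) | i <- enum 'I_n]; last first.
  move=> _ /mapP[i _ ->]; apply/gJ; exists (fun j => (j == i)%:R).
  rewrite (bigD1 i) //= eqxx scale1r big1 ?addr0 // => j /negPf ->.
  by rewrite scale0r.
split=> [|x gx].
  have /gJ[c ac] := aJ; apply: contrapT => g0; case/eqP: a0; rewrite ac big1 // => i _.
  have [->|gi0] := eqVneq (g i) 0; first by rewrite scaler0.
  by case: g0; exists (g i) => //; apply/mapP; exists i => //; rewrite mem_enum.
apply: (GV_ideal_base GVJ) => b /gJ[c ->].
rewrite rmorph_sum /= mulr_suml; apply: rpred_sum => i _.
rewrite rmorphM -mulrA; apply/base_predM/gx.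
by apply/mapP; exists i => //; rewrite mem_enum.
Qed.

Lemma span_seq_fg s : finitely_generated (span (fun a : R^o => a \in (s : seq R))).
Proof.
exists (size s), (fun i => s`_i) => x; split; last first.
  by move=> [c ->]; apply: rpred_sum => i _; apply/rpredZ/mem_span/mem_nth.
apply: (span_ind (P := fun x : R^o => exists c : 'I_(size s) -> R,
  x = \sum_(i < size s) c i *: (s`_i : R^o))).
- by exists (fun=> 0); rewrite big1 // => i _; rewrite scale0r.
- move=> k _ _ [c ->] [d ->]; exists (fun i => k * c i + d i).
  rewrite scaler_sumr -big_split; apply: eq_bigr => i _ /=.
  by rewrite scalerDl scalerA.
- move=> _ /(nthP 0)[i si <-]; exists (fun j => (j == Ordinal si)%:R).
  rewrite (bigD1 (Ordinal si)) //= eqxx scale1r big1 ?addr0 // => j /negPf ->.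
  by rewrite scale0r.
Qed.

(** A linear form f satisfies a0 f(b) = b f(a0), so it is multiplication by the fraction f(a0) / a0.
    This fraction sends s into R, hence lies in R. *)
Lemma gv_family_GV s : gv_family s ->
  GV_ideal (span (fun a : R^o => a \in (s : seq R))).
Proof.
move=> [[a0 a0s a00] s_inv]; set J := span _; split.
  exact: span_seq_fg.
move=> f; pose b0 : submod J := Submod (mem_span a0s).
have a0F : a0%:F != 0 by rewrite tofrac_eq0.
pose x := (f b0 : R)%:F / a0%:F.
have fx (b : submod J) : (f b : R)%:F = (val b : R)%:F * x.
  apply: (mulfI a0F); rewrite /x mulrCA [_%:F * (_ / _)]mulrCA divff // mulr1.
  rewrite -!rmorphM; congr (_%:F).
  have : val b *: b0 = a0 *: b by apply: val_inj; exact: mulrC.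
  by move/(congr1 f); rewrite !linearZ => ->.
have /asboolP[r xr] : x \in @base_pred R.
  apply: s_inv => a sa; rewrite -[a in a%:F]/(val (Submod (mem_span sa) : submod J)).
  by rewrite -fx tofrac_base.
exists r; split=> [b|r' fr'].
  by apply: (@tofrac_inj R); rewrite fx xr -rmorphM mulrC.
apply: (mulIf a00); rewrite -[RHS](fr' b0).
by apply: (@tofrac_inj R); rewrite fx xr -rmorphM mulrC.
Qed.

Lemma gv_family1 : gv_family [:: 1].
Proof.
split=> [|x]; first by exists 1; rewrite ?mem_head ?oner_eq0.
by move/(_ 1 (mem_head _ _)); rewrite rmorph1 mul1r.
Qed.

Lemma gv_familyM s t : gv_family s -> gv_family t ->
  gv_family [seq a * b | a <- s, b <- t].
Proof.
move=> [[a sa a0] s_inv] [[b tb b0] t_inv]; split=> [|x stx].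
  by exists (a * b); [exact: allpairs_f | rewrite mulf_neq0].
apply: s_inv => c sc; apply: t_inv => d td.
by rewrite mulrA -rmorphM mulrC mulrC [d * c]mulrC stx // allpairs_f.
Qed.

Lemma contains_gv_neq0 I : contains_gv I -> exists2 a, a \in I & a != 0.
Proof. by move=> [s [[a sa a0] _] sI]; exists a => //; exact: sI. Qed.

Lemma contains_gv_GV I : contains_gv I -> exists2 J, GV_ideal J & {subset J <= I}.
Proof.
move=> [s gv_s sI]; eexists; first exact: gv_family_GV gv_s.
exact: span_min.
Qed.

Lemma GV_sub_contains_gv I J : GV_ideal J -> {subset J <= I} -> contains_gv I.
Proof. by move=> /GV_ideal_contains_gv[s gv_s sJ] JI; exists s => // a /sJ/JI. Qed.

(** Injectivity of E extends i to a map h on R. A GV-ideal inside I sends h 1 into the image of I,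
    so h 1 = i c with c in I, and a c = a for a nonzero a in I forces c = 1. *)
Lemma w_ideal_gv_one I : w_ideal I -> contains_gv I -> (1 : R^o) \in I.
Proof.
move=> [_ [E [i [[injE i_inj _] iw]]]] cI; have [a aI a0] := contains_gv_neq0 cI.
have [J GVJ JI] := contains_gv_GV cI.
have [h hE] := injE _ _ (val : submod I -> R^o) i val_inj.
have hI (b : R^o) (bI : b \in I) : b *: h 1 = i (Submod bI).
  by rewrite -hE -linearZ /=; congr (h _); exact: mulr1.
have /iw[[c cI'] h1] : w_envelope i (h 1).
  by exists J => // b Jb; exists (Submod (JI _ Jb)); exact: hI.
suff -> : (1 : R^o) = c by [].
apply: (mulfI a0); have := hI a aI; rewrite h1 -linearZ => /i_inj/(congr1 val).
by move=> ac; rewrite mulr1; exact: esym ac.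
Qed.

Lemma w_maximal_no_gv (m : wMax R) : ~ contains_gv m.
Proof. by case: (wMaxP m) => wm /negP + _ => + cm; apply; exact: w_ideal_gv_one. Qed.

Lemma zero_module_injective (E : lmodType R) :
  (forall x : E, x = 0) -> injective_module E.
Proof. by move=> E0 M N f g _; exists \0 => x; rewrite (E0 (g x)). Qed.

(* A nonzero ideal has the injective envelope K, the zero ideal has 0. *)
Lemma w_idealP I :
    (forall a s, gv_family s -> (forall b, b \in s -> b * a \in I) -> a \in I) ->
  w_ideal I.
Proof.
move=> wI; split.
  move=> x J /GV_ideal_neq0[c cJ c0] /(_ c cJ)/(congr1 val)/eqP.
  rewrite linearZ linear0 /= mulf_eq0 (negPf c0) /= => /eqP x0.
  exact: val_inj.
have [[a aI a0]|I0] := pselect (exists2 a : R^o, a \in I & a != 0); last first.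
  have I_eq0 (x : submod I) : x = 0.
    apply: val_inj; apply: contrapT => /eqP x0; apply: I0.
    by exists (val x) => //; exact: submodP.
  exists (submod I), idfun; split; first split=> //.
  - exact: zero_module_injective.
  - by move=> S [y Sy]; rewrite (I_eq0 y) eqxx.
  move=> y; split=> [_|_]; first by exists y.
  have [J GVJ _] := contains_gv_GV (I := span (fun a : R^o => a \in [:: 1 : R]))
    (ex_intro2 _ _ _ gv_family1 (fun a => mem_span (x := a : R^o))).
  by exists J => // b _; exists (b *: y).
pose i (x : submod I) : fraction_module R := (val x : R)%:F.
have i_lin : linear i.
  by move=> k x y; rewrite /i linearP rmorphD rmorphM.
pose iL : {linear submod I -> fraction_module R} :=
  HB.pack i (GRing.isLinear.Build _ _ _ _ i i_lin).
have i_inj : injective i.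
  by move=> x y /tofrac_inj; exact: val_inj.
exists (fraction_module R), iL; split; first split=> //.
- exact: fraction_injective.
(* Essentiality: for y = b / c nonzero in S, the multiple (a c) y = b a is a nonzero element of
   I. *)
- move=> S [y Sy y0]; have [b [c [c0 ybc]]] := fractionP y.
  have acI : ((b * a)%R : R^o) \in I by exact: idealMl.
  exists (Submod acI).
    apply/eqP => /(congr1 val)/= /eqP; rewrite mulf_eq0 (negPf a0) orbF => /eqP b0.
    by case/eqP: y0; rewrite ybc b0 rmorph0 mul0r.
  have -> : iL (Submod acI) = (a * c) *: y; last exact: rpredZ.
  rewrite [LHS]/=; change ((b * a)%:F = (a * c)%:F * (y : K)).
  by rewrite ybc !rmorphM -mulrA [c%:F * _]mulrC divfK ?tofrac_eq0 // mulrC.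
move=> y; split=> [[J GVJ Jy]|[x ->]]; last first.
  have [J GVJ _] := contains_gv_GV (I := span (fun a : R^o => a \in [:: 1 : R]))
    (ex_intro2 _ _ _ gv_family1 (fun a => mem_span (x := a : R^o))).
  by exists J => // b _; exists (b *: x); rewrite linearZ.
have /asboolP[r yr] : (y : K) \in @base_pred R.
  apply: (GV_ideal_base GVJ) => b /Jy[x yx].
  have -> : b%:F * (y : K) = (val x : R)%:F by exact: yx.
  exact: tofrac_base.
have [s gv_s sJ] := GV_ideal_contains_gv GVJ.
have rI : (r : R^o) \in I.
  apply: (wI r s gv_s) => b /sJ/Jy[x yx].
  suff -> : b * r = val x by exact: submodP.
  apply: (@tofrac_inj R); transitivity (b%:F * (y : K)); last exact: yx.
  by rewrite yr -rmorphM.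
by exists (Submod rI).
Qed.

(* An ideal maximal among those without GV-families is a w-ideal: if Ja <= I,
   a GV-family in I + Ra multiplied by J lands in I. *)
Lemma exists_wMax I : ~ contains_gv I -> exists m : wMax R, {subset I <= m}.
Proof.
move=> noI.
pose Q (X : R -> Prop) := [/\ X 0, forall a u v, X u -> X v -> X (a * u + v)
  & forall s, gv_family s -> ~ forall a, a \in s -> X a].
have [||X [[X0 XZD noX] IX Xmax]] := Zorn_above (Q := Q) (S0 := fun a : R => (a : R^o) \in I).
- split=> [|a u v Iu Iv|s gv_s sI]; first exact: rpred0.
    by apply: rpredD => //; exact: idealMl.
  by apply: noI; exists s.
- move=> C [Y0 CY0] CQ totC; split=> [|a u v [Y CY Yu] [Z CZ Zv]|s gv_s sC].
  + by exists Y0 => //; case: (CQ _ CY0).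
  + have [YZ|ZY] := totC Y Z CY CZ.
      by exists Z => //; have [_ ZD _] := CQ _ CZ; apply: ZD => //; exact: YZ.
    by exists Y => //; have [_ YD _] := CQ _ CY; apply: YD => //; exact: ZY.
  + have [Z CZ sZ] := chain_finite (ex_intro _ Y0 CY0) totC (h := id) sC.
    by have [_ _ noZ] := CQ _ CZ; exact: (noZ s).
pose m := submod_pred (M := R^o) X0 XZD.
have mP (a : R) : (a : R^o) \in m <-> X a by split=> /asboolP.
have m1 : (1 : R^o) \notin m.
  apply/negP => /mP X1; apply: (noX _ gv_family1) => a.
  by rewrite inE => /eqP ->.
have Qsub J : {subset m <= J} -> ~ contains_gv J -> {subset J <= m}.
  move=> mJ noJ a Ja; apply/mP; move: a Ja; apply: Xmax; last by move=> b /mP/mJ.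
  split=> [|a u v Ju Jv|s gv_s sJ]; first exact: rpred0.
    by apply: rpredD => //; exact: idealMl.
  by apply: noJ; exists s.
have wm : w_ideal m.
  apply: w_idealP => a s gv_s sa.
  pose P (u : R^o) := exists (v : R^o) r, v \in m /\ u = v + r * a.
  have P0 : P 0 by exists 0, 0; rewrite rpred0 mul0r addr0.
  have PZD k u v : P u -> P v -> P (k *: u + v).
    move=> [u' [r [mu ->]]] [v' [r' [mv ->]]]; exists (k *: u' + v'), (k * r + r').
    split; first by rewrite rpredD ?rpredZ.
    by rewrite [k *: _]mulrDr mulrDl mulrA addrACA.
  have mPa : {subset m <= submod_pred P0 PZD}.
    by move=> u mu; apply/asboolP; exists u, 0; rewrite mul0r addr0.
  apply: (Qsub _ mPa); last first.
    by apply/asboolP; exists 0, 1; rewrite rpred0 mul1r add0r.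
  move=> [t gv_t tP]; apply: (noX _ (gv_familyM gv_s gv_t)).
  move=> _ /allpairsP[[b c] /= [sb tc ->]]; apply/mP.
  have /asboolP[v [r [mv ->]]] := tP c tc.
  rewrite mulrDr mulrCA; apply: rpredD; first exact: idealMl.
  by apply: idealMl; exact: sa.
have max_m : w_maximal m.
  (* A w-ideal without 1 contains no GV-family, so the maximality of m applies to it. *)
  split=> // I' wI' /negP I'1 mI'; apply: Qsub => // cI'.
  exact/I'1/w_ideal_gv_one.
by exists (WMax max_m) => a Ia; apply/mP/IX.
Qed.

(** The annihilator of x lies in no maximal w-ideal, so it contains a GV-ideal. *)
Lemma GV_torsion_local (M : lmodType R) :
    (forall (x : M) (m : wMax R), exists2 s : R, (s : R^o) \notin m & s *: x = 0) ->
  GV_torsion M.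
Proof.
move=> locM x.
have ann0 : (0 : R^o) *: x = 0 by rewrite scale0r.
have annZD (k : R) (a b : R^o) : a *: x = 0 -> b *: x = 0 -> (k *: a + b) *: x = 0.
  by move=> ax bx; rewrite scalerDl -scalerA ax bx scaler0 addr0.
pose ann := submod_pred (P := fun a : R^o => a *: x = 0) ann0 annZD.
have [/contains_gv_GV[J GVJ Jann]|/exists_wMax[m ann_m]] := pselect (contains_gv ann).
  by exists J => // a /Jann/asboolP.
have [s /negP ms sx] := locM x m; case: ms; apply: ann_m; exact/asboolP.
Qed.

End GVFamilies.

(** * PvMDs and valuation rings R_m *)

Section Valuation.
Variable R : idomainType.
Local Notation K := {fraction R}.
Local Notation "x %:F" := (@FracField.tofrac R x).
Implicit Types (I : submodClosed R^o) (m : wMax R) (x y z : K).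

Definition local_dvd m x y : Prop :=
  exists r s : R, (s : R^o) \notin m /\ s%:F * y = r%:F * x.

(* That R_m is a valuation ring. *)
Definition locally_valuation m : Prop :=
  forall x y, local_dvd m x y \/ local_dvd m y x.

Lemma wMax_notinM m (s t : R) : (s : R^o) \notin m -> (t : R^o) \notin m ->
  (s * t : R^o) \notin m.
Proof.
by move=> sm tm; apply/negP => /(w_maximal_prime (wMaxP m))[]; apply/negP.
Qed.

Lemma wMax_notin1 m : (1 : R^o) \notin m.
Proof. by case: (wMaxP m). Qed.

Lemma wMax_notin_neq0 m (s : R) : (s : R^o) \notin m -> s != 0.
Proof. by apply: contraNneq => ->; exact: rpred0. Qed.

(** Pairwise comparison finds a member of the list dividing all others in R_m; s is a common
    denominator of the quotients. *)
Lemma local_dvd_seq m (x0 : R) (t : seq R) : locally_valuation m ->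
  exists2 k : R, k \in x0 :: t & exists2 s : R, (s : R^o) \notin m
    & forall a, a \in x0 :: t -> exists r : R, s * a = r * k.
Proof.
move=> val_m; elim: t => [|b t [k k_in [s sm sk]]].
  exists x0; rewrite ?mem_head //; exists 1; first exact: wMax_notin1.
  by move=> a; rewrite inE => /eqP ->; exists 1.
have [[r [s' [sm' sb]]]|[r [s' [sm' sb]]]] := val_m k%:F b%:F;
    move: sb; rewrite -!rmorphM => /tofrac_inj sb.
  exists k; first by move: k_in; rewrite !inE => /predU1P[->|->]; rewrite ?eqxx ?orbT.
  exists (s * s'); first exact: wMax_notinM.
  move=> a; rewrite inE orbC inE -orbA [_ || (_ == x0)]orbC -in_cons.
  case/predU1P => [->|/sk[r' e]]; first by exists (s * r); rewrite -mulrA sb mulrA.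
  by exists (s' * r'); rewrite mulrAC e mulrC mulrA.
exists b; first by rewrite !inE eqxx orbT.
exists (s * s'); first exact: wMax_notinM.
move=> a; rewrite inE orbC inE -orbA [_ || (_ == x0)]orbC -in_cons.
case/predU1P => [->|/sk[r' e]]; first by exists (s * s').
by exists (r' * r); rewrite mulrAC e -!mulrA [k * _]mulrC sb.
Qed.

Lemma mul_inverseMl I (a : R) x :
  (x : fraction_module R) \in mul_inverse I ->
  (a%:F * x : fraction_module R) \in mul_inverse I.
Proof. exact: (@rpredZ _ _ (mul_inverse I) a x). Qed.

Lemma mul_inverse_base I (x : fraction_module R) :
  x \in mul_inverse I -> (x : K) \in @base_pred R.
Proof.
apply: (span_ind (P := fun x : fraction_module R => (x : K) \in @base_pred R)).
- exact: rpred0.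
- by move=> a u v Ru Rv; apply: rpredD => //; exact: base_predM.
- by move=> _ [a [y [aI Iy ->]]]; apply/asboolP; exact: Iy.
Qed.

Lemma PvMD_valuation m : PvMD R -> locally_valuation m.
Proof.
move=> pvmd x y.
have loc0 z : local_dvd m z 0.
  by exists 0, 1; split; rewrite ?wMax_notin1 // mulr0 rmorph0 mul0r.
have [->|x0] := eqVneq x 0; first by right.
have [a [b [b0 xy]]] := fractionP (y / x).
have [a0|a0] := eqVneq a 0.
  move: xy; rewrite a0 rmorph0 mul0r => /eqP; rewrite mulf_eq0 invr_eq0 (negPf x0).
  by rewrite orbF => /eqP ->; left.
have abx : b%:F * y = a%:F * x.
  by rewrite -[y](divfK x0) xy mulrA mulrCA divff ?mulr1 // tofrac_eq0.
pose I := span (fun c : R^o => c \in [:: a; b]).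
have aI : (a : R^o) \in I by apply: mem_span; rewrite mem_head.
have bI : (b : R^o) \in I by apply: mem_span; rewrite !inE eqxx orbT.
have I_neq0 : exists2 c : R^o, c \in I & c != 0 by exists a.
have /(_ (1%:F : K))[_ [|J GVJ JI]] := pvmd I (span_seq_fg _) I_neq0.
  by exists 1.
(* If i z is outside m for some i in I and z in I^-1, write i = c a + d b: then a z or b z is
   outside m, and (b z) y = (a z) x is the required divisibility. *)
have [[i [z [iI Iz [r [irz rm]]]]]|no_unit] := pselect (exists (i : R) z,
    [/\ (i : R^o) \in I, in_inverse I z
      & exists r : R, i%:F * z = r%:F /\ (r : R^o) \notin m]).
  have [ra za] := Iz a aI; have [rb zb] := Iz b bI.
  have [c [d icd]] : exists c d : R, i = c * a + d * b.
    apply: (span_ind (P := fun i : R^o => exists c d : R, i = c * a + d * b) _ _ _ iI).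
    - by exists 0, 0; rewrite !mul0r addr0.
    - move=> k _ _ [c [d ->]] [c' [d' ->]]; exists (k * c + c'), (k * d + d').
      by rewrite [k *: _]mulrDr !mulrDl !mulrA addrACA.
    - move=> j; rewrite !inE => /orP[] /eqP ->.
        by exists 1, 0; rewrite mul1r mul0r addr0.
      by exists 0, 1; rewrite mul1r mul0r add0r.
  have rcd : r = c * ra + d * rb.
    apply: (@tofrac_inj R); rewrite -irz icd !rmorphD !rmorphM /= -za -zb mulrDl.
    by rewrite -!mulrA.
  have z0 : z != 0.
    by apply: contraNneq (wMax_notin_neq0 rm) => z0; rewrite -tofrac_eq0 -irz z0 mulr0.
  have xy_ratio : rb%:F * y = ra%:F * x by rewrite -za -zb mulrAC abx mulrAC.
  have [rbm|rbm] := boolP ((rb : R^o) \in m); last by left; exists ra, rb.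
  right; exists rb, ra; split=> //; apply: contraNN rm => ram; rewrite rcd.
  by apply: rpredD; exact: idealMl.
(* Otherwise m contains I I^-1, hence the GV-ideal J. *)
case: (@w_maximal_no_gv _ m); apply: GV_sub_contains_gv GVJ _ => c Jc.
have [u cu] := JI c Jc.
have := submodP u; have <- : c%:F = val u :> fraction_module R.
  by rewrite -[LHS]mulr1 -(rmorph1 (@FracField.tofrac R)); exact: cu.
move=> cI; suff [r mr /tofrac_inj ->] : exists2 r : R, (r : R^o) \in m & c%:F = r%:F by [].
apply: (span_ind (P := fun x : fraction_module R =>
  exists2 r : R, (r : R^o) \in m & (x : K) = r%:F) _ _ _ cI).
- by exists 0; rewrite ?rpred0 ?rmorph0.
- move=> k _ _ [r mr ->] [r' mr' ->]; exists (k * r + r').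
    by apply: rpredD => //; exact: idealMl.
  by rewrite rmorphD rmorphM.
- move=> _ [i [z [iI Iz ->]]]; have [r izr] := Iz i iI; exists r => //.
  by apply: contrapT => /negP rm; apply: no_unit; exists i, z; split=> //; exists r.
Qed.

Lemma valuation_PvMD : (forall m, locally_valuation m) -> PvMD R.
Proof.
move=> val_R I [n [g gI]] [a0 a0I a00] x.
(* The elements of R lying in I I^-1 already form an ideal; the span only packages them as one. *)
have IP (c : R) : (c : R^o) \in span (fun c : R^o => (c : R)%:F \in mul_inverse I) ->
  (c%:F : fraction_module R) \in mul_inverse I.
  apply: (span_ind (P := fun c : R^o => (c%:F : fraction_module R) \in mul_inverse I)) => //.
    by rewrite rmorph0 rpred0.
  by move=> a u v Iu Iv; rewrite rmorphD rmorphM; exact: (rpredD (mul_inverseMl a Iu) Iv).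
split=> [[J GVJ Jx]|[r ->]].
  apply/asboolP/(GV_ideal_base GVJ) => a /Jx[u au].
  suff -> : a%:F * (x : K) = val u by exact/mul_inverse_base/submodP.
  exact: au.
have [/contains_gv_GV[J GVJ JI]|/exists_wMax[m mI]] :=
    pselect (contains_gv (span (fun c : R^o => (c : R)%:F \in mul_inverse I))).
  exists J => // a /JI/IP aI.
  have raI : (a%:F * r%:F : K) \in mul_inverse I.
    by rewrite mulrC; exact: mul_inverseMl.
  by exists (Submod raI).
have g_in i : g i \in I.
  apply/gI; exists (fun j => (j == i)%:R).
  rewrite (bigD1 i) //= eqxx scale1r big1 ?addr0 // => j /negPf ->.
  by rewrite scale0r.
(* Up to the factor s, the element k of I divides a0 and all generators of I, so s / k lies in I^-1
   and s = k (s / k) lies in I I^-1 but not in m. The presence of the nonzero a0 in the list makes k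
   nonzero. *)
have [k k_in [s sm sk]] := local_dvd_seq a0 [seq (g i : R) | i <- enum 'I_n] (val_R m).
have k0 : k != 0.
  have [|r' e] := sk a0; first exact: mem_head.
  apply: contraNneq a00 => kz; move/eqP: e; rewrite kz mulr0 mulf_eq0.
  by rewrite (negPf (wMax_notin_neq0 sm)).
have kI : (k : R^o) \in I.
  move: k_in; rewrite inE => /predU1P[->//|/mapP[i _ ->]]; exact: g_in.
case/negP: sm; apply: mI; apply: mem_span.
apply: mem_span; exists k, (s%:F / k%:F); split=> //; last first.
  by rewrite mulrCA divff ?mulr1 // tofrac_eq0.
move=> c /gI[d ->]; apply/(asboolP (exists r, _ = r%:F)).
change ((\sum_(i < n) d i *: g i : R)%:F * (s%:F / k%:F) \in @base_pred R).
rewrite mulrC rmorph_sum mulr_sumr; apply: rpred_sum => i _.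
rewrite rmorphM mulrCA; apply: base_predM.
have [|r' e] := sk (g i).
  by rewrite inE; apply/orP; right; apply/mapP; exists i => //; rewrite mem_enum.
rewrite mulrAC -rmorphM e rmorphM mulfK ?tofrac_eq0 //; exact: tofrac_base.
Qed.

End Valuation.

(** * Flatness of localized overrings *)

Section LocalizedOverrings.
Variable R : idomainType.
Local Notation K := {fraction R}.
Local Notation "x %:F" := (@FracField.tofrac R x).
Implicit Types (m : wMax R) (T : overring R) (x y z : K).

Lemma localization_baseP m x : reflect
  (exists r s : R, (s : R^o) \notin m /\ x = r%:F / s%:F)
  (x \in localization (base R) m).
Proof.
apply: (iffP idP) => [/asboolP[_ [s [/asboolP[r ->] ms ->]]]|[r [s [ms ->]]]].
  by exists r, s.
by apply/asboolP; exists r%:F, s; split=> //; exact: tofrac_base.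
Qed.

Lemma local_dvd_ratio m x y : local_dvd m x y ->
  exists2 a : K, a \in localization (base R) m & y = a * x.
Proof.
move=> [r [s [sm sy]]]; exists (r%:F / s%:F).
  by apply/localization_baseP; exists r, s.
by rewrite mulrAC -sy mulrC mulKf // tofrac_eq0 (wMax_notin_neq0 sm).
Qed.

Lemma localized_common_denominator T m (x : overring_type (localization T m)) :
  exists d a : overring_type (localization (base R) m),
    (forall y : overring_type (localization T m), localized_incl T m d * y = 0 -> y = 0) /\
    localized_incl T m d * x = localized_incl T m a.
Proof.
have [a [b [b0 xab]]] := fractionP (val x).
exists (OverringElt (overring_frac (localization (base R) m) b)).
exists (OverringElt (overring_frac (localization (base R) m) a)).
split=> [y /(congr1 val)/eqP|].
  rewrite rmorphM rmorph0 mulf_eq0 /= tofrac_eq0 (negPf b0) /= => /eqP y0.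
  by apply: val_inj; rewrite rmorph0.
by apply: val_inj; rewrite rmorphM /= xab mulrC divfK // tofrac_eq0.
Qed.

Lemma valuation_flat T m : locally_valuation m -> flat (restrict (localized_incl T m)).
Proof.
move=> val_m; apply: flat_directed => [a x /(congr1 val)/eqP|x y].
  rewrite [X in X == _](rmorphM val) [X in _ == X]rmorph0 mulf_eq0.
  by case/orP => /eqP e; [left|right]; apply: val_inj; rewrite rmorph0.
have [/local_dvd_ratio[a am e]|/local_dvd_ratio[a am e]] := val_m (val x) (val y).
  exists x, 1, (OverringElt am); split; first by rewrite scale1r.
  exact: val_inj.
exists y, (OverringElt am), 1; split; last by rewrite scale1r.
exact: val_inj.
Qed.

(** * From flat overrings to valuation rings *)

Section Chevalley.
Variable m : wMax R.

(* The maximal ideal of R_m. *)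
Definition local_max x : Prop :=
  exists p s : R, [/\ (p : R^o) \in m, (s : R^o) \notin m & x = p%:F / s%:F].

Lemma local_max0 : local_max 0.
Proof. by exists 0, 1; rewrite rpred0 wMax_notin1 rmorph0 mul0r. Qed.

Lemma local_maxD x y : local_max x -> local_max y -> local_max (x + y).
Proof.
move=> [p [s [pm sm ->]]] [q [t [qm tm ->]]]; exists (t * p + s * q), (s * t); split.
- by apply: rpredD; exact: idealMl.
- exact: wMax_notinM.
rewrite addf_div ?tofrac_eq0 ?(wMax_notin_neq0 sm) ?(wMax_notin_neq0 tm) // -!rmorphM -rmorphD.
by rewrite [p * t]mulrC [q * s]mulrC.
Qed.

Lemma local_maxMl a x : a \in localization (base R) m -> local_max x ->
  local_max (a * x).
Proof.
move=> /localization_baseP[r [s [sm ->]]] [q [t [qm tm ->]]]; exists (r * q), (s * t).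
by rewrite idealMl ?wMax_notinM // mulf_div !rmorphM.
Qed.

Lemma local_max_or_unit a : a \in localization (base R) m ->
  local_max a \/ a^-1 \in localization (base R) m.
Proof.
move=> /localization_baseP[r [s [sm ->]]].
have [rm|rm] := boolP ((r : R^o) \in m); [left | right]; first by exists r, s.
by apply/localization_baseP; exists s, r; rewrite invf_div.
Qed.

Lemma local_max_1sub x : local_max x ->
  1 - x != 0 /\ (1 - x)^-1 \in localization (base R) m.
Proof.
move=> [p [s [pm sm ->]]]; have spm : (s - p : R^o) \notin m.
  by apply: contraNN sm => spm; rewrite -[s](subrK p) rpredD.
have s0 : s%:F != 0 by rewrite tofrac_eq0 (wMax_notin_neq0 sm).
have -> : 1 - p%:F / s%:F = (s - p)%:F / s%:F by rewrite rmorphB mulrBl divff.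
split; first by rewrite mulf_neq0 ?invr_eq0 // tofrac_eq0 (wMax_notin_neq0 spm).
by apply/localization_baseP; exists s, (s - p); rewrite invf_div.
Qed.

(** The unit ideal of R_m[x] is generated by m R_m, with a bound n on the number of terms that
    serves for descent. *)
Definition local_max_unity n x : Prop :=
  exists2 c : nat -> K, (forall i, local_max (c i)) & \sum_(i < n) c i * x ^+ i = 1.

(* Solve the relation for 1/x for x^n and substitute it for the leading term. *)
Lemma local_max_unity_descent n x : x != 0 ->
  local_max_unity n.+1 x -> local_max_unity n.+1 x^-1 -> local_max_unity n x.
Proof.
move=> x0 [a am ax] [b bm bx]; have [b0 ub0] := local_max_1sub (bm 0%N).
exists (fun i => a i + a n * (1 - b 0%N)^-1 * b (n - i)%N).
  move=> i; apply: local_maxD; first exact: am.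
  rewrite mulrC; apply: local_maxMl; last by rewrite mulrC; exact: local_maxMl.
  have [p [s [pm sm ->]]] := bm (n - i)%N; apply/localization_baseP.
  by exists p, s.
(* The relation for 1/x, with its constant term moved across, multiplied by x^n and summed in
   reverse order. *)
have bxn : \sum_(i < n) b (n - i)%N * x ^+ i = (1 - b 0%N) * x ^+ n.
  rewrite -bx big_ord_recl expr0 mulr1 addrAC subrr add0r mulr_suml.
  rewrite [LHS](reindex_inj rev_ord_inj) /=; apply: eq_bigr => i _.
  rewrite /bump /= add1n subKn // -mulrA; congr (_ * _).
  have xn : x ^+ n = x ^+ i.+1 * x ^+ (n - i.+1) by rewrite -exprD subnKC.
  by rewrite exprVn xn mulKf ?expf_neq0.
under eq_bigr do rewrite mulrDl -mulrA.
by rewrite big_split -mulr_sumr bxn -mulrA mulKf // -ax [RHS]big_ord_recr.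
Qed.

(** Descent applies to x and to 1/x alike, so both relations shrink together down to the empty sum,
    which is not 1. *)
Lemma local_max_unityF n x : x != 0 ->
  local_max_unity n x -> local_max_unity n x^-1 -> False.
Proof.
move=> x0; elim: n => [|n IHn] ux uVx.
  by case: ux => c _ /eqP; rewrite big_ord0 eq_sym oner_eq0.
apply: IHn; apply: local_max_unity_descent; rewrite ?invrK ?invr_eq0 //.
Qed.

Lemma local_max_unity_widen n k x : (n <= k)%N ->
  local_max_unity n x -> local_max_unity k x.
Proof.
move=> nk [c cm cx]; exists (fun i => if (i < n)%N then c i else 0).
  by move=> i; case: ifP => // _; exact: local_max0.
rewrite -cx [RHS](big_ord_widen k (fun i => c i * x ^+ i) nk) [RHS]big_mkcond.
by apply: eq_bigr => i _; case: ifP => //; rewrite mul0r.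
Qed.

Section Adjoin.
Variable x : K.
Local Notation A := (localization (base R) m).

Definition adjoin_pred : {pred K} :=
  fun y => `[< exists2 p : {poly K}, p \is a polyOver A & y = p.[x] >].

Fact adjoin_subring_closed : subring_closed adjoin_pred.
Proof.
split=> [|_ _ /asboolP[p pA ->] /asboolP[q qA ->]
         |_ _ /asboolP[p pA ->] /asboolP[q qA ->]]; apply/asboolP.
- by exists 1; rewrite ?rpred1 ?hornerE.
- by exists (p - q); rewrite ?rpredB ?hornerE.
- by exists (p * q); rewrite ?rpredM ?hornerM.
Qed.
HB.instance Definition _ :=
  GRing.isSubringClosed.Build K adjoin_pred adjoin_subring_closed.

Fact adjoin_sub a : a \in A -> a \in adjoin_pred.
Proof. by move=> aA; apply/asboolP; exists a%:P; rewrite ?polyOverC ?hornerC. Qed.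

Definition adjoin : overring R :=
  Overring (fun r => adjoin_sub (overring_frac A r)).

(** R_m[x] is already local at m: elements of R outside m are units in it. *)
Lemma localization_adjoin y : y \in localization adjoin m -> y \in adjoin_pred.
Proof.
move=> /asboolP[t [s [Tt sm ->]]]; apply: rpredM => //; apply: adjoin_sub.
by apply/localization_baseP; exists 1, s; rewrite rmorph1 div1r.
Qed.

Lemma adjoin_flat_unity : x \notin A -> flat (restrict (localized_incl adjoin m)) ->
  exists n, local_max_unity n x.
Proof.
move=> xA flatT; have xT : x \in localization adjoin m.
  apply/asboolP; exists x, 1; split; rewrite ?wMax_notin1 ?rmorph1 ?divr1 //.
  by apply/asboolP; exists 'X; rewrite ?polyOverX ?hornerX.
have := one_in_denominator_ideal (@localized_common_denominator adjoin m) flatT (OverringElt xT).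
pose F := restrict (localized_incl adjoin m).
pose P (z : F) := exists2 q : {poly K}, (forall i, local_max q`_i)
  & val (z : overring_type _) = q.[x].
move=> one_in; have [|a u v [p pm pu] [q qm qv]|_ [c [y [[a ca] ->]]]|q qm q1] :=
  span_ind (P := P) _ _ _ one_in.
- by exists 0; rewrite ?horner0 // => i; rewrite coef0; exact: local_max0.
- exists (val a *: p + q); last first.
    by rewrite hornerD hornerZ -pu -qv.
  move=> i; rewrite coefD coefZ; apply: local_maxD => //.
  by apply: local_maxMl => //; exact: overring_valP.
(* If c were a unit of R_m, then c x in R_m would put x in R_m. *)
- have cm : local_max (val c).
    have [//|cV] := local_max_or_unit (overring_valP c).
    have [c0|c0] := eqVneq (val c) 0; first by rewrite c0; exact: local_max0.
    case/negP: xA; have <- : (val c)^-1 * val a = x; last first.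
      by apply: rpredM => //; exact: overring_valP.
    by move/(congr1 val): ca => /= <-; rewrite mulKf.
  have /localization_adjoin/asboolP[p pA yp] := overring_valP y.
  exists (val c *: p); last by rewrite hornerZ -yp.
  move=> i; rewrite coefZ mulrC; apply: local_maxMl => //; exact/polyOverP.
- exists (size q), (fun i => q`_i) => //.
  by rewrite -horner_coef -q1.
Qed.

End Adjoin.

Lemma flat_valuation :
  (forall T, flat (restrict (localized_incl T m))) -> locally_valuation m.
Proof.
move=> flat_all x y.
have [->|x0] := eqVneq x 0.
  by right; exists 0, 1; rewrite wMax_notin1 mulr0 rmorph0 mul0r.
have [->|y0] := eqVneq y 0.
  by left; exists 0, 1; rewrite wMax_notin1 mulr0 rmorph0 mul0r.
have ratio_dvd u v : u != 0 -> v / u \in localization (base R) m -> local_dvd m u v.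
  move=> u0 /localization_baseP[r [s [sm vu]]]; exists r, s; split=> //.
  have s0 : s%:F != 0 by rewrite tofrac_eq0 (wMax_notin_neq0 sm).
  by rewrite -[v](divfK u0) vu mulrA mulrCA divff // mulr1.
have [xy|xy] := boolP (y / x \in localization (base R) m); first by left; exact: ratio_dvd.
have [yx|yx] := boolP (x / y \in localization (base R) m); first by right; exact: ratio_dvd.
have [n un] := adjoin_flat_unity xy (flat_all _).
have [k uk] := adjoin_flat_unity yx (flat_all _).
case: (@local_max_unityF (maxn n k) (y / x)).
- by rewrite mulf_neq0 ?invr_eq0.
- exact: local_max_unity_widen (leq_maxl _ _) un.
- by rewrite invf_div; exact: local_max_unity_widen (leq_maxr _ _) uk.
Qed.

End Chevalley.
End LocalizedOverrings.

(** With z a cycle representing u, every a z is a cycle, and a u vanishes as soon as a z is a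
    boundary. *)
Lemma homology_annihilator (A : comNzRingType) (L M N : lmodType A)
    (g : {linear L -> M}) (f : {linear M -> N}) (u : homology g f) :
  exists z, forall a : A,
    (f (a *: z) = 0 -> exists l, g l = a *: z) -> a *: u = 0.
Proof.
have /eqP u0 : f (val (repr u)) == 0 by exact: (submodP (repr u)).
exists (val (repr u)) => a; rewrite linearZ /= u0 scaler0 => /(_ erefl) az.
rewrite -[u]quotmod_pi_repr -linearZ.
rewrite -(linear0 (quotmod_pi _)); apply/eqP; rewrite quotmod_piE subr0.
exact/asboolP.
Qed.

Lemma submod_scale_eq0 (A : nzRingType) (M : lmodType A) (S : submodClosed M)
  (a : A) (x : submod S) : a *: val x = 0 -> a *: x = 0.
Proof. by move=> ax; apply: val_inj; rewrite linearZ linear0. Qed.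

(** * Torsion of Tor and of the multiplication map, one m at a time *)

Section WFlat.
Variables (R : idomainType) (T : overring R).
Local Notation K := {fraction R}.
Local Notation "x %:F" := (@FracField.tofrac R x).
Local Notation F := (restrict (overring_incl T)).
Hypothesis valR : forall m : wMax R, locally_valuation m.

Lemma restrict_overring_scale (a : R) (t : F) :
  val (a *: t : overring_type T) = a%:F * val (t : overring_type T).
Proof. by []. Qed.

Lemma restrict_overring_torsion_free (a : R) (t : F) : a *: t = 0 -> a = 0 \/ t = 0.
Proof.
move/(congr1 (val : overring_type T -> K))/eqP; rewrite restrict_overring_scale.
rewrite [X in _ == X]rmorph0 mulf_eq0 tofrac_eq0 => /orP[] /eqP; [by left|right].
by apply: val_inj; rewrite rmorph0.
Qed.

(* R_m (x) T is a directed union of copies of R_m. *)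
Lemma tensor_overring_local (m : wMax R) (M : lmodType R) (z : tensor M F) :
  exists2 s : R, (s : R^o) \notin m & exists x t, s *: z = tens x t.
Proof.
elim/tensor_ind: z => [x t|u v [s sm [x [t su]]] [s' sm' [x' [t' sv]]]].
  by exists 1; [exact: wMax_notin1 | exists x, t; rewrite scale1r].
(* By symmetry t may be assumed to divide t' over R_m; then c t' = r t brings both tensors over
   t. *)
wlog [r [c [cm ct]]] : u v s sm x t su s' sm' x' t' sv /
    local_dvd m (val (t : overring_type T)) (val (t' : overring_type T)).
  move=> wl; have [tt'|t't] := valR m (val (t : overring_type T)) (val (t' : overring_type T)).
    exact: (wl u v s sm x t su s' sm' x' t' sv tt').
  by rewrite addrC; exact: (wl v u s' sm' x' t' sv s sm x t su t't).
have {}ct : c *: t' = r *: t by exact: val_inj.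
exists (c * (s * s')); first by rewrite !wMax_notinM.
exists ((c * s') *: x + (s * r) *: x'), t.
rewrite scalerDr linearDl /= !tensZl; congr (_ + _).
  by rewrite [s * s']mulrC mulrA -scalerA su.
by rewrite mulrCA -!scalerA sv -[c *: _]tensZr ct tensZr.
Qed.

Lemma coeff_scale (X : choiceType) (n : X) (a : R) (w : {freeg X / R}) :
  coeff n (a *: w) = a * coeff n w.
Proof. exact: coeff_fgscale. Qed.

(** The target of f is free and T is torsion-free, so f w (x) t = 0 with t nonzero kills every
    coordinate of f w. Hence w is in the kernel and is the image of a generator of the syzygy
    module. *)
Lemma tensor_syzygy_exact (M : lmodType R) (X : choiceType)
    (f : {linear M -> {freeg X / R}}) (w : M) (t : F) :
    tensor_map f (idfun : {linear F -> F}) (tens w t) = 0 ->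
  exists l, tensor_map (syzygy f) (idfun : {linear F -> F}) l = tens w t.
Proof.
rewrite tensor_mapE /= => wt0; have [->|t0] := eqVneq t 0.
  by exists 0; rewrite linear0 linear0r.
have w0 : f w = 0.
  apply/eqP/freeg_eqP => n; rewrite coeff0.
  have := tens_eq0 (g := fun (v : {freeg X / R}) (t : F) => coeff n v *: t) _ wt0.
  move=> /(_ _)/restrict_overring_torsion_free[|//|e]; last by rewrite e eqxx in t0.
  split=> [y a v v'|v a y y'] /=; first by rewrite coeffD coeff_scale scalerDl scalerA.
  by rewrite scalerDr !scalerA mulrC.
have wker : w \in ker f by exact/eqP.
exists (tens << (Submod wker) >> t); rewrite tensor_mapE; congr tens.
by rewrite [LHS]free_liftU scale1r.
Qed.

(** Stated for any map into a free module; [Tor1] is the case of [resolution1]. *)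
Lemma homology_syzygy_local (m : wMax R) (M : lmodType R) (X : choiceType)
    (f : {linear M -> {freeg X / R}})
    (u : homology (tensor_map (syzygy f) (idfun : {linear F -> F}))
                  (tensor_map f (idfun : {linear F -> F}))) :
  exists2 s : R, (s : R^o) \notin m & s *: u = 0.
Proof.
have [z zu] := homology_annihilator u.
have [s sm [w [t szt]]] := tensor_overring_local m z.
exists s => //; apply: zu; rewrite szt; exact: tensor_syzygy_exact.
Qed.

Lemma overring_w_flat : w_flat F.
Proof.
by move=> N; apply: GV_torsion_local => u m; exact: homology_syzygy_local.
Qed.

(** Near m an element of the kernel is a single tensor y (x) t with y t = 0, and T is a domain. The
    cokernel is zero, since 1 (x) t maps to t. *)
Lemma overring_w_epimorphism : w_epimorphism (overring_incl T).
Proof.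
have multE (x y : F) : mult_map (overring_incl T) (tens x y) =
    (x : overring_type T) * (y : overring_type T) :> overring_type T.
  exact: (tensor_liftE (@restrict_mul _ _ (overring_incl T))).
split; apply: GV_torsion_local => x m.
  have /eqP x0 : mult_map (overring_incl T) (val x) == 0 by exact: (submodP x).
  have [s sm [y [t sz]]] := tensor_overring_local m (val x).
  exists s => //; apply: submod_scale_eq0; rewrite sz.
  have /(congr1 (val : overring_type T -> K))/eqP : mult_map (overring_incl T) (tens y t) = 0.
    by rewrite -sz linearZ /= x0 scaler0.
  rewrite multE rmorphM rmorph0 mulf_eq0 => /orP[] /eqP e.
    have -> : y = 0 by apply: val_inj; rewrite [LHS]e rmorph0.
    by rewrite linear0l.
  have -> : t = 0 by apply: val_inj; rewrite [LHS]e rmorph0.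
  by rewrite linear0r.
exists 1; rewrite ?wMax_notin1 // scale1r -[x]quotmod_pi_repr.
rewrite -(linear0 (quotmod_pi _)); apply/eqP; rewrite quotmod_piE subr0.
apply/asboolP; exists (tens (1 : F) (repr x)).
by rewrite [LHS]multE mul1r.
Qed.

End WFlat.

(** * Assembly of the equivalences *)

Theorem theorem4p4 (R : idomainType) :
  let condition2 :=
    forall (T : overring R) (m : wMax R), flat_epimorphism (localized_incl T m) in
  [/\ PvMD R <-> condition2,
      forall (T : overring R) (m : wMax R),
        flat_epimorphism (localized_incl T m) <->
        bijective (mult_map (localized_incl T m)) /\
        flat (restrict (localized_incl T m))
    & condition2 ->
      forall T : overring R,
        w_flat (restrict (overring_incl T)) /\
        w_epimorphism (overring_incl T)].
Proof.
move=> condition2.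
(* T_m consists of fractions over R_m, so its flatness gives the epimorphism property. *)
have epi T m : flat (restrict (localized_incl T m)) -> ring_epimorphism (localized_incl T m).
  exact/flat_fractions_epi/localized_common_denominator.
have valR : condition2 -> forall m : wMax R, locally_valuation m.
  by move=> c2 m; apply: flat_valuation => T; case: (c2 T m).
split=> [|T m|/valR val T].
- split=> [pvmd T m|/valR]; last exact: valuation_PvMD.
  have flatT := valuation_flat (T := T) (PvMD_valuation m pvmd).
  by split; first exact: epi.
- split=> [[_ flatT]|[_ flatT]]; split=> //; last exact: epi.
  by apply: flat_fractions_mult_bij flatT; exact: localized_common_denominator.
- by split; [exact: overring_w_flat | exact: overring_w_epimorphism].
Qed.
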